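(* Let $\Omega\subset\mathbb{R}^n$ be a bounded domain and $1<p<\infty$. Let $v$ be a weight on $\Omega$ with $v\in L^1(\Omega)$, and let $Q$ be a measurable, symmetric, nonnegative definite $n\times n$ matrix function on $\Omega$ with $|Q(x)|_{\mathrm{op}}^{p/2}\le k\,v(x)$ for a.e. $x\in\Omega$ (some constant $k$). Suppose that for some $\sigma>p-1$ the Sobolev inequality $$\|\varphi\|_{L^N(v,\Omega)}\le S_N\|\nabla\varphi\|_{QL^p(\Omega)}\qquad\text{for all }\varphi\in \mathrm{Lip}_0(\Omega)$$ holds with $N(t)=t^{p}\log(e+t)^\sigma$. Let $\alpha>\frac{p-1}{\sigma-p+1}$ and let $f\in L^A(v,\Omega)$, where $A(t)=\exp(t^\alpha)-1$. Then there is a constant $C$, depending only on $A,N,p,S_N,\Omega,v$ (and in particular independent of $u$ and $f$), such that every degenerate weak subsolution $u\in QH^{1,p}_0(v,\Omega)$ of the Dirichlet problem (D$_0$) (see context) satisfies $$\|u^+\|_{L^\infty(v,\Omega)}\le C\,\|f\|_{L^A(v,\Omega)},$$ and every degenerate weak supersolution $u\in QH^{1,p}_0(v,\Omega)$ of (D$_0$) satisfies the same bound with $u^-$ in place of $u^+$. In particular, if $u$ is a degenerate weak solution of (D$_0$), then $u\in L^\infty(v,\Omega)$ with this bound.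
   Context: A weight $v$ is a nonnegative measurable function; $v(E)=\int_E v\,dx$. $L^p(v,\Omega)$ is the Lebesgue space with respect to the measure $v\,dx$, and $\|\cdot\|_{L^\infty(v,\Omega)}$ is the essential supremum with respect to $v\,dx$. For an increasing function $\Phi:[0,\infty)\to[0,\infty)$ with $\Phi(0)=0$, $\|h\|_{L^\Phi(v,\Omega)}=\inf\{\lambda>0:\int_\Omega \Phi(|h|/\lambda)\,v\,dx\le 1\}$, and $L^\Phi(v,\Omega)$ is the set of measurable $h:\Omega\to\mathbb{R}$ for which this is finite. $\mathrm{Lip}_0(\Omega)$ is the set of locally Lipschitz functions with compact support in $\Omega$. $QL^p(\Omega)$ is the space of measurable $\mathbf g:\Omega\to\mathbb{R}^n$ with $\|\mathbf g\|_{QL^p(\Omega)}=(\int_\Omega|\sqrt{Q}\,\mathbf g|^p\,dx)^{1/p}<\infty$, with functions identified when their difference has norm $0$. $QH^{1,p}_0(v,\Omega)$ is the completion of $\mathrm{Lip}_0(\Omega)$ in the norm $\|\psi\|_{L^p(v,\Omega)}+\|\nabla\psi\|_{QL^p(\Omega)}$; its elements are identified with pairs $(u,\nabla u)\in L^p(v,\Omega)\times QL^p(\Omega)$ that are limits in $L^p(v,\Omega)\times QL^p(\Omega)$ of sequences $(\psi_j,\nabla\psi_j)$ with $\psi_j\in\mathrm{Lip}_0(\Omega)$. Here ''$\nabla u$'' is notation for the second component (it need not be a classical weak gradient), and one writes $u\in QH^{1,p}_0(v,\Omega)$ for the pair. The Dirichlet problem (D$_0$) is, formally, $$-v^{-1}\mathrm{div}(|\sqrt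 Q\nabla u|^{p-2}Q\nabla u)=f|f|^{p-2}\ \text{in }\Omega,\qquad u=0\text{ on }\partial\Omega.$$ A pair $(u,\nabla u)\in QH^{1,p}_0(v,\Omega)$ is a degenerate weak solution of (D$_0$) if $$\int_\Omega|\sqrt Q\nabla u|^{p-2}\,\nabla\varphi\cdot Q\nabla u\,dx=\int_\Omega f|f|^{p-2}\varphi\,v\,dx$$ for every $\varphi\in\mathrm{Lip}_0(\Omega)$. It is a degenerate weak subsolution (supersolution) if this holds with ''$=$'' replaced by ''$\le$'' (''$\ge$'') for every nonnegative $\varphi\in\mathrm{Lip}_0(\Omega)$. Expressions $|w|^{p-2}w$ are $0$ where $w=0$. Finally $u^+=\max(u,0)$, $u^-=\max(-u,0)$. *)

(* Defs.v *)
From HB Require Import structures.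
From mathcomp Require Import all_boot all_order all_algebra.
From mathcomp Require Import all_classical all_reals all_analysis.

Set Implicit Arguments.
Unset Strict Implicit.
Unset Printing Implicit Defensive.

Import Order.TTheory GRing.Theory Num.Theory.
Import numFieldNormedType.Exports.

Local Open Scope classical_set_scope.
Local Open Scope ring_scope.

(* Points of the (n+1)-dimensional space are rows ['rV[R]_n.+1], so that every
   dimension is at least 1; gradients and other vector fields take values in
   columns ['cV[R]_n.+1].  The library has no Lebesgue measure beyond dimension
   1, so it is built here by Caratheodory's construction from coverings by
   half-open boxes. *)

Section lebesgue_rV.
Variables (R : realType) (n : nat).
Implicit Types (a b : 'rV[R]_n.+1) (ab : nat -> 'rV[R]_n.+1 * 'rV[R]_n.+1).

Definition box a b : set 'rV[R]_n.+1 :=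
  [set x | forall i, a ord0 i < x ord0 i <= b ord0 i].

Definition box_vol a b : R := \prod_i Num.max 0 (b ord0 i - a ord0 i).

Definition leb_outer (X : set 'rV[R]_n.+1) : \bar R :=
  ereal_inf [set (\sum_(k <oo) (box_vol (ab k).1 (ab k).2)%:E)%E | ab in
    [set ab | X `<=` \bigcup_k box (ab k).1 (ab k).2]].

Local Open Scope ereal_scope.

Lemma box_vol_ge0 a b : 0 <= (box_vol a b)%:E.
Proof. by rewrite lee_fin; apply: prodr_ge0 => i _; rewrite le_max lexx. Qed.

Let series_ge0 ab : 0 <= \sum_(k <oo) (box_vol (ab k).1 (ab k).2)%:E.
Proof. by apply: nneseries_ge0 => *; exact: box_vol_ge0. Qed.

Lemma leb_outer_ge0 X : 0 <= leb_outer X.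
Proof. by apply: le_ereal_inf_tmp => _ [ab _ <-]; exact: series_ge0. Qed.

Lemma leb_outer0 : leb_outer set0 = 0.
Proof.
apply/eqP; rewrite eq_le leb_outer_ge0 andbT.
apply: ereal_inf_lbound; exists (fun=> (0%R, 0%R)) => //.
apply: lim_near_cst => //; apply: nearW => m; rewrite big1// => k _.
by rewrite /box_vol/= big_ord_recl subrr maxxx mul0r.
Qed.

Lemma le_leb_outer : {homo leb_outer : A B / A `<=` B >-> A <= B}.
Proof.
move=> A B AB; apply/ereal_inf_le_tmp => _ [ab abB <-].
by exists ab => //; exact: subset_trans abB.
Qed.

Lemma leb_outer_sigma_subadditive : sigma_subadditive leb_outer.
Proof.
move=> A; have [[i ioo]|] := pselect (exists i, leb_outer (A i) = +oo).
  rewrite (eseries_pinfty _ _ ioo) ?leey// => j _.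
  by rewrite -ltNye (lt_le_trans _ (leb_outer_ge0 _)).
rewrite -forallNE => Aoo.
suff add2e (e : {posnum R}) :
    leb_outer (\bigcup_n A n) <= \sum_(i <oo) leb_outer (A i) + e%:num%:E.
  by apply/lee_addgt0Pr => _/posnumP[].
rewrite (le_trans _ (epsilon_trick _ _ _))//; last first.
  by move=> m; exact: leb_outer_ge0.
pose v (c : 'rV[R]_n.+1 * 'rV[R]_n.+1) := (box_vol c.1 c.2)%:E.
have v0 c : 0 <= v c by exact: box_vol_ge0.
pose P m ab := A m `<=` \bigcup_k box (ab k).1 (ab k).2 /\
  \sum_(k <oo) v (ab k) <= leb_outer (A m) + (e%:num / (2 ^ m.+1)%:R)%:E.
have [G PG] : {G & forall m, P m (G m)}.
  apply: (@choice _ _ P) => m; rewrite /P /leb_outer.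
  set S := (X in ereal_inf X); move infS : (ereal_inf S) => iS.
  case: iS infS => [r Sr|Soo|Soo].
  - have en1 : (0 < e%:num / (2 ^ m.+1)%:R)%R by [].
    have /(lb_ereal_inf_adherent en1) : ereal_inf S \is a fin_num by rewrite Sr.
    move=> [x [B AnB muBx] xS].
    by exists B; split => //; rewrite [X in X <= _]muBx -Sr; exact/ltW.
  - by have := Aoo m; rewrite /leb_outer Soo.
  - suff : lbound S 0 by move/le_ereal_inf_tmp; rewrite Soo.
    by move=> _ [B _ <-]; exact: series_ge0.
pose w (ij : nat * nat) := v (G ij.1 ij.2).
have w0 ij : 0 <= w ij by exact: v0.
apply: (@le_trans _ _ (\esum_(i in setT) w i)).
  apply: ereal_inf_lbound => /=.
  have /card_esym/ppcard_eqP[f] := card_nat2.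
  exists (fun k => G (f k).1 (f k).2).
    move=> t [i _ /(PG i).1 [j _ Bijt]].
    by exists (f^-1%FUN (i, j)) => //=; rewrite invK ?inE.
  rewrite -(esum_pred_image w f xpredT) ?[fun=> _]set_true//.
  by rewrite image_eq.
rewrite (_ : esum _ _ = \sum_(i <oo) \sum_(j <oo ) w (i, j)); last first.
  pose J : nat -> set (nat * nat) := fun i => [set (i, j) | j in setT].
  rewrite (_ : setT = \bigcup_k J k); last first.
    by rewrite predeqE => -[a b]; split => // _; exists a => //; exists b.
  rewrite esum_bigcupT //=; last first.
    apply/trivIsetP => i j _ _ ij.
    rewrite predeqE => -[l m] /=; split => //= -[] [_] _ [<-{l} _].
    by move=> [m' _] [] /esym/eqP; rewrite (negbTE ij).
  rewrite -(image_id [set: nat]) -fun_true esum_pred_image//; last first.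
    by move=> l _; exact: esum_ge0.
  apply: eq_eseriesr => /= j _.
  rewrite -(esum_pred_image w (pair j) predT)//=; last first.
    by move=> ? ? _ _; exact: (@can_inj _ _ _ snd).
  by congr esum; rewrite predeqE => -[a b]; split; move=> [i _ <-]; exists i.
apply: lee_lim.
- apply: is_cvg_nneseries => m *.
  by apply: nneseries_ge0 => k *; exact: w0.
- by apply: is_cvg_nneseries => m *; apply: adde_ge0 => //; exact: leb_outer_ge0.
- by apply: nearW => m; apply: lee_sum => i _; exact: (PG i).2.
Qed.

HB.instance Definition _ := isOuterMeasure.Build R 'rV[R]_n.+1 leb_outer
  leb_outer0 leb_outer_ge0 le_leb_outer leb_outer_sigma_subadditive.

End lebesgue_rV.

(* The measurable subsets of ['rV[R]_n.+1] are the Lebesgue measurable ones,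
   not just the Borel ones. *)
HB.instance Definition _ (R : realType) (n : nat) :=
  @isMeasurable.Build (caratheodory_display (@leb_outer R n)) 'rV[R]_n.+1
    (@leb_outer R n).-caratheodory
    (caratheodory_measurable_set0 (@leb_outer R n))
    (@caratheodory_measurable_setC _ _ (@leb_outer R n))
    (@caratheodory_measurable_bigcup _ _ (@leb_outer R n)).

Definition leb (R : realType) (n : nat) : set 'rV[R]_n.+1 -> \bar R :=
  @leb_outer R n.
Arguments leb : clear implicits.

HB.instance Definition _ (R : realType) (n : nat) :=
  isMeasure.Build _ 'rV[R]_n.+1 R (leb R n)
    (@caratheodory_measure0 _ _ (@leb_outer R n))
    (@caratheodory_measure_ge0 _ _ (@leb_outer R n))
    (@caratheodory_measure_sigma_additive _ _ (@leb_outer R n)).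

Section vectors.
Variables (R : realType) (n : nat).
Implicit Types (w : 'cV[R]_n) (A : 'M[R]_n).

Definition dot w1 w2 : R := \sum_i w1 i ord0 * w2 i ord0.

(* Euclidean norm: the library's [`|w|] is the sup norm. *)
Definition enorm w : R := Num.sqrt (dot w w).

Definition nonneg_definite A : Prop := forall w, 0 <= dot w (A *m w).

Definition op_norm A : R :=
  sup [set enorm (A *m w) | w in [set w | enorm w <= 1]].

(* The symmetric nonnegative definite square root; arbitrarily 0 when there is
   none. *)
Definition sqrtmx A : 'M[R]_n :=
  xget 0 [set S | [/\ S^T = S, nonneg_definite S & S *m S = A]].

End vectors.

Section spaces.
Variables (R : realType) (n : nat).
Local Notation E := 'rV[R]_n.+1.
Implicit Types (Omega : set E) (v h u f phi : E -> R).
Implicit Types (g : E -> 'cV[R]_n.+1) (Q : E -> 'M[R]_n.+1) (Phi : R -> R).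

Definition bounded_domain Omega : Prop :=
  [/\ Omega !=set0, open Omega, connected Omega & bounded_set Omega].

Definition weight Omega v : Prop :=
  measurable_fun Omega v /\ forall x, Omega x -> 0 <= v x.

Definition weight_meas v (A : set E) : \bar R :=
  (\int[leb R n]_(x in A) (v x)%:E)%E.

Definition Lp_norm v Omega (p : R) h : \bar R :=
  ((\int[leb R n]_(x in Omega) (`|h x| `^ p * v x)%:E) `^ p^-1)%E.

Definition in_Lp v Omega (p : R) h : Prop :=
  measurable_fun Omega h /\ (Lp_norm v Omega p h < +oo)%E.

(* Essential supremum of |h| with respect to v dx; restricting to 0 <= M makes it
   0, not -oo, when v vanishes almost everywhere. *)
Definition Linfty_norm v Omega h : \bar R :=
  ereal_inf [set M%:E | M in
    [set M : R | 0 <= M /\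
       weight_meas v (Omega `&` [set x | M < `|h x|]) = 0%E]].

Definition in_Linfty v Omega h : Prop :=
  measurable_fun Omega h /\ (Linfty_norm v Omega h < +oo)%E.

Definition orlicz_norm Phi v Omega h : \bar R :=
  ereal_inf [set l%:E | l in
    [set l : R | 0 < l /\
       (\int[leb R n]_(x in Omega) (Phi (`|h x| / l) * v x)%:E <= 1)%E]].

Definition in_orlicz Phi v Omega h : Prop :=
  measurable_fun Omega h /\ (orlicz_norm Phi v Omega h < +oo)%E.

(* A function on [Omega] with compact support in [Omega] is represented by its
   extension by 0. *)
Definition Lip0 Omega phi : Prop :=
  [/\ forall x, Omega x ->
        exists2 U : set E, nbhs x U & [lipschitz phi y | y in U],
      compact (closure [set x | phi x != 0])
    & closure [set x | phi x != 0] `<=` Omega].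

(* The partial derivatives of a locally Lipschitz function exist almost
   everywhere; ['D_w] takes a default value elsewhere. *)
Definition grad phi (x : E) : 'cV[R]_n.+1 :=
  \col_i 'D_(delta_mx ord0 i) phi x.

Definition QLp_norm Q Omega (p : R) g : \bar R :=
  ((\int[leb R n]_(x in Omega) (enorm (sqrtmx (Q x) *m g x) `^ p)%:E)
     `^ p^-1)%E.

Definition in_QLp Q Omega (p : R) g : Prop :=
  (forall i, measurable_fun Omega (fun x => g x i ord0)) /\
  (QLp_norm Q Omega p g < +oo)%E.

(* Membership of the pair (u, g), where g plays the role of "nabla u". *)
Definition QH0 v Q Omega (p : R) u g : Prop :=
  [/\ in_Lp v Omega p u, in_QLp Q Omega p g
    & exists psi : nat -> E -> R,
      [/\ forall j, Lip0 Omega (psi j),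
          (fun j => Lp_norm v Omega p (psi j \- u)) @ \oo --> 0%E
        & (fun j => QLp_norm Q Omega p (fun x => grad (psi j) x - g x))
            @ \oo --> 0%E]].

Definition dirichlet_lhs Q Omega (p : R) g phi : \bar R :=
  (\int[leb R n]_(x in Omega)
     (enorm (sqrtmx (Q x) *m g x) `^ (p - 2) *
      dot (grad phi x) (Q x *m g x))%:E)%E.

Definition dirichlet_rhs v Omega (p : R) f phi : \bar R :=
  (\int[leb R n]_(x in Omega)
     (f x * `|f x| `^ (p - 2) * phi x * v x)%:E)%E.

Definition weak_solution v Q Omega (p : R) f u g : Prop :=
  QH0 v Q Omega p u g /\
  forall phi, Lip0 Omega phi ->
    dirichlet_lhs Q Omega p g phi = dirichlet_rhs v Omega p f phi.

Definition weak_subsolution v Q Omega (p : R) f u g : Prop :=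
  QH0 v Q Omega p u g /\
  forall phi, Lip0 Omega phi -> (forall x, 0 <= phi x) ->
    (dirichlet_lhs Q Omega p g phi <= dirichlet_rhs v Omega p f phi)%E.

Definition weak_supersolution v Q Omega (p : R) f u g : Prop :=
  QH0 v Q Omega p u g /\
  forall phi, Lip0 Omega phi -> (forall x, 0 <= phi x) ->
    (dirichlet_rhs v Omega p f phi <= dirichlet_lhs Q Omega p g phi)%E.

Definition sobolev_inequality Phi v Q Omega (p S : R) : Prop :=
  forall phi, Lip0 Omega phi ->
    (orlicz_norm Phi v Omega phi <= S%:E * QLp_norm Q Omega p (grad phi))%E.

End spaces.

Definition N_young (R : realType) (p sigma : R) (t : R) : R :=
  t `^ p * (ln (expR 1 + t)) `^ sigma.

Definition A_young (R : realType) (alpha : R) (t : R) : R :=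
  expR (t `^ alpha) - 1.

(* Main.v *)
(* De Giorgi iteration.  Let [mu = v dx] and let [psi] in [Lip0] approximate the
   subsolution [u] together with its gradient.  Testing with [phi = (psi - r)^+],
   whose gradient is [1_{psi > r} grad psi], and using the Sobolev inequality gives
     [||phi||_N^p <= S^p int |sqrt Q grad phi|^p <= c int |f|^(p-1) phi dmu + small].
   If [mu {psi > r} <= K0 e^-l] then [int phi^p dmu <= c l^-sigma ||phi||_N^p], while
   the exponential integrability of [f] bounds [int_{psi > r} |f|^p dmu] by
   [c ||f||_A^p l^(p/alpha) e^-l].  After absorbing [int phi^p dmu] by Young's
   inequality and letting [psi] tend to [u],
     [int ((u - r)^+)^p dmu <= c ||f||_A^p l^(-p theta) e^-l]
   with [theta = sigma / (p - 1) - 1 / alpha], and [theta > 1] is exactly the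
   assumption on [alpha].  Hence raising the level from [r] by a multiple of
   [||f||_A k^-theta] at the [k]-th step divides the bound on [mu {u > r}] by [e],
   and the increments are summable.

   The test functions are truncations of the approximants, never of [u], so that no
   chain rule is needed for pairs [(u, gradu)]; and as ['D_w] is 0 where it does not
   exist, the formula for the gradient of a truncation holds everywhere, so that
   Rademacher's theorem is not needed either. *)
Require Import Defs.
From mathcomp Require Import all_boot all_order all_algebra.
From mathcomp Require Import all_classical all_reals all_analysis.
From mathcomp Require Import measurable_realfun spectral sesquilinear complex.
From mathcomp Require Import ring lra.

Set Implicit Arguments.
Unset Strict Implicit.
Unset Printing Implicit Defensive.

Import Order.TTheory GRing.Theory Num.Theory.
Import numFieldNormedType.Exports.

Local Open Scope classical_set_scope.
Local Open Scope ring_scope.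

(** * Elementary inequalities *)

Section real_inequalities.
Variable R : realType.
Implicit Types (p q s t d x y h tau l alpha sigma : R).

Lemma le_powR q x y : 0 <= q -> 0 <= x -> x <= y -> x `^ q <= y `^ q.
Proof.
by move=> q0 x0 xy; apply: ge0_ler_powR; rewrite ?nnegrE// (le_trans x0).
Qed.

Lemma powR_subr2 p s : 1 < p -> 0 <= s -> s `^ (p - 2) * s = s `^ (p - 1).
Proof.
move=> p1 s0; rewrite -(@mulr_powRB1 _ s (p - 1))// ?subr_gt0// mulrC.
by congr (_ * _ `^ _); lra.
Qed.

(** Constants of the two cases of [coercivity]: if d <= s/2 then t <= 3s/2 and x >= s^2/2; otherwise
    s <= 2d and t <= 3d, and everything is a multiple of d^p. *)
Definition coercivity_cst (p : R) : R := 2 * (3 / 2) `^ p.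
Definition coercivity_err (p : R) : R := 3 `^ p + coercivity_cst p * (2 `^ (p - 1) * 3).

Lemma coercivity_cst_gt0 p : 0 < coercivity_cst p.
Proof. by rewrite mulr_gt0 ?powR_gt0//; lra. Qed.

Lemma coercivity_err_gt0 p : 0 < coercivity_err p.
Proof.
by rewrite ltr_wpDr ?powR_gt0 ?mulr_ge0 ?powR_ge0 ?ltW ?coercivity_cst_gt0//; lra.
Qed.

(* [s], [t], [d], [x] stand for [|b|], [|a|], [|a - b|] and the inner product of [a]
   and [b]; either [a] is close to [b], or everything is controlled by [|a - b|]. *)
Lemma coercivity p s t d x : 1 < p -> 0 <= s -> 0 <= t -> 0 <= d ->
  t <= s + d -> `|x| <= s * t -> s ^+ 2 - s * d <= x ->
  t `^ p <= coercivity_cst p * (s `^ (p - 2) * x) + coercivity_err p * d `^ p.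
Proof.
move=> p1 s0 t0 d0 tsd xst sdx.
have p0 : 0 <= p by lra.
have K0 : 0 <= coercivity_cst p by rewrite ltW// coercivity_cst_gt0.
have [ds|sd] := leP d (s / 2).
  rewrite ler_wpDr ?mulr_ge0 ?powR_ge0 ?(ltW (coercivity_err_gt0 _))//.
  have sx : s `^ p / 2 <= s `^ (p - 2) * x.
    have -> : s `^ p / 2 = s `^ (p - 2) * (s ^+ 2 / 2).
      by rewrite expr2 !mulrA powR_subr2// [_ * s]mulrC mulr_powRB1//; lra.
    rewrite ler_wpM2l ?powR_ge0// (le_trans _ sdx)// expr2.
    have : s * d <= s * (s / 2) by rewrite ler_wpM2l.
    lra.
  apply: (@le_trans _ _ (coercivity_cst p * (s `^ p / 2))); last by rewrite ler_wpM2l.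
  rewrite (_ : coercivity_cst p * _ = (3 / 2) `^ p * s `^ p); last first.
    by rewrite /coercivity_cst; field.
  have h32 : 0 <= 3 / 2 :> R by lra.
  by rewrite -powRM//; apply: le_powR => //; lra.
have s2 : s `^ (p - 1) <= 2 `^ (p - 1) * d `^ (p - 1).
  by rewrite -powRM//; apply: le_powR; lra.
have t3 : t `^ p <= 3 `^ p * d `^ p by rewrite -powRM//; apply: le_powR; lra.
have xd : `|s `^ (p - 2) * x| <= 2 `^ (p - 1) * 3 * d `^ p.
  rewrite normrM (ger0_norm (powR_ge0 _ _)).
  apply: (@le_trans _ _ (s `^ (p - 2) * (s * t))).
    by rewrite ler_wpM2l ?powR_ge0.
  rewrite mulrA powR_subr2// -(@mulr_powRB1 _ d p)//; last by lra.
  rewrite [leRHS](_ : _ = 2 `^ (p - 1) * d `^ (p - 1) * (3 * d)); last by ring.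
  by apply: ler_pM; rewrite ?powR_ge0//; lra.
have xd' : coercivity_cst p * - (s `^ (p - 2) * x) <=
    coercivity_cst p * (2 `^ (p - 1) * 3 * d `^ p).
  by rewrite ler_wpM2l// (le_trans _ xd)// -normrN ler_norm.
rewrite (le_trans t3)// /coercivity_err -subr_ge0.
rewrite [leRHS](_ : _ = coercivity_cst p * (2 `^ (p - 1) * 3 * d `^ p) -
  coercivity_cst p * - (s `^ (p - 2) * x)); last by ring.
by rewrite subr_ge0.
Qed.

Lemma powR_triangle p s t d : 0 <= p -> 0 <= s -> 0 <= t -> 0 <= d ->
  t <= s + d -> t `^ p <= 2 `^ p * (s `^ p + d `^ p).
Proof.
move=> p0 s0 t0 d0 tsd; have [sd|/ltW ds] := leP s d.
  apply: (@le_trans _ _ ((2 * d) `^ p)); first by apply: le_powR => //; lra.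
  by rewrite powRM// ler_wpM2l ?powR_ge0// lerDr powR_ge0.
apply: (@le_trans _ _ ((2 * s) `^ p)); first by apply: le_powR => //; lra.
by rewrite powRM// ler_wpM2l ?powR_ge0// lerDl powR_ge0.
Qed.

(** Young's inequality with non-optimal constants: if h^(p-1) <= tau y^(p-1) the first term
    suffices; otherwise y <= tau^(-1/(p-1)) h and the second does. *)
Lemma powR_young p tau h y : 1 < p -> 0 < tau -> 0 <= h -> 0 <= y ->
  h `^ (p - 1) * y <= tau * y `^ p + tau^-1 `^ (p - 1)^-1 * h `^ p.
Proof.
move=> p1 tau0 h0 y0; have p10 : 0 < p - 1 by lra.
have p0 : 0 < p by lra.
have [hy|/ltW yh] := leP (h `^ (p - 1)) (tau * y `^ (p - 1)).
  rewrite ler_wpDr ?mulr_ge0 ?powR_ge0//.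
  apply: (le_trans (ler_wpM2r y0 hy)).
  by rewrite -mulrA [_ * y]mulrC mulr_powRB1.
rewrite ler_wpDl ?mulr_ge0 ?powR_ge0// ?(ltW tau0)//.
have yh' : y <= tau^-1 `^ (p - 1)^-1 * h.
  have rt z : 0 <= z -> z = (z `^ (p - 1)) `^ (p - 1)^-1.
    by move=> z0; rewrite -powRrM mulfV ?gt_eqF// powRr1.
  rewrite [leLHS]rt// [X in _ * X]rt//.
  rewrite -powRM ?powR_ge0 ?invr_ge0 ?(ltW tau0)//.
  apply: le_powR; rewrite ?powR_ge0 ?ler_pdivlMl//.
  by rewrite invr_ge0 ltW.
apply: (le_trans (ler_wpM2l (powR_ge0 _ _) yh')).
by rewrite mulrCA [_ * h]mulrC mulr_powRB1.
Qed.

(** The inequality z <= e^z at z = y/(2q), raised to the power q. *)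
Lemma powR_le_expR q y : 0 < q -> 0 <= y -> y `^ q <= (2 * q) `^ q * expR (y / 2).
Proof.
move=> q0 y0.
have yq : y <= 2 * q * expR (y / (2 * q)).
  rewrite mulrC -ler_pdivrMr; last by lra.
  by rewrite (le_trans _ (expR_ge1Dx _))// lerDr.
apply: (le_trans (le_powR (ltW q0) y0 yq)).
rewrite powRM ?expR_ge0//; last by lra.
rewrite -expRM.
rewrite (_ : y / (2 * q) * q = y / 2)//; field; lra.
Qed.

(** The two terms cover h^alpha <= 2l and h^alpha > 2l. In the second case a power of y = h^alpha is
    at most a multiple of e^(y/2) = e^(-y/2) e^y, where e^(-y/2) <= e^(-l), and e^y <= 2 (e^y - 1)
    because y > 2. *)
Lemma powR_le_exp_young p alpha h l : 1 < p -> 0 < alpha -> 0 <= h -> 1 <= l ->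
  h `^ p <= (2 * l) `^ (p / alpha) +
    2 * (2 * (p / alpha)) `^ (p / alpha) * expR (- l) * A_young alpha h.
Proof.
move=> p1 a0 h0 l1; have q0 : 0 < p / alpha by rewrite divr_gt0//; lra.
have hp : h `^ p = (h `^ alpha) `^ (p / alpha).
  by rewrite -powRrM mulrC divfK// gt_eqF.
rewrite hp /A_young; set y := h `^ alpha.
have y0 : 0 <= y by exact: powR_ge0.
have ey : 0 <= expR y - 1 by rewrite subr_ge0 -expR0 ler_expR.
have [yl|ly] := leP y (2 * l).
  apply: ler_wpDr; first by rewrite !mulr_ge0 ?powR_ge0 ?expR_ge0.
  by apply: le_powR => //; exact: ltW.
rewrite ler_wpDl ?powR_ge0// (le_trans (powR_le_expR q0 y0))//.
set c := _ `^ _; have c0 : 0 <= c by exact: powR_ge0.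
rewrite (_ : 2 * c * _ * _ = c * (2 * expR (- l) * (expR y - 1))); last by ring.
rewrite ler_wpM2l//.
have -> : expR (y / 2) = expR (- (y / 2)) * expR y.
  by rewrite -expRD; congr expR; field.
have e1 : expR (- (y / 2)) <= expR (- l) by rewrite ler_expR; lra.
have e2 : expR y <= 2 * (expR y - 1).
  by have := expR_ge1Dx y; lra.
rewrite -mulrA mulrCA; apply: (le_trans (ler_wpM2r (expR_ge0 _) e1)).
by rewrite ler_wpM2l ?expR_ge0.
Qed.

Lemma N_young_ge0 p sigma t : 0 <= t -> 0 <= N_young p sigma t.
Proof. by move=> t0; rewrite mulr_ge0 ?powR_ge0. Qed.

(** The two terms cover ln t <= l/(2p) and ln t > l/(2p); in the second case log(e + t) exceeds
    l/(2p), which pays for the factor. The indicator of t <> 0 lets the first term be integrated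
    over the support only. *)
Lemma powR_le_N_young p sigma t l : 1 < p -> 0 < sigma -> 0 <= t -> 0 < l ->
  t `^ p <= (t != 0)%:R * expR (l / 2) + (2 * p / l) `^ sigma * N_young p sigma t.
Proof.
move=> p1 s0 t0 l0; have p0 : 0 < p by lra.
have [->|tn0] := eqVneq t 0.
  rewrite powR0 ?gt_eqF// mul0r add0r.
  by rewrite mulr_ge0 ?powR_ge0 ?N_young_ge0.
have {}t0 : 0 < t by rewrite lt_neqAle eq_sym tn0.
rewrite mul1r; have [tl|lt] := leP (ln t) (l / (2 * p)).
  rewrite ler_wpDr ?mulr_ge0 ?powR_ge0 ?N_young_ge0 ?(ltW t0)//.
  rewrite /powR gt_eqF// ler_expR -ler_pdivlMl//.
  by rewrite (_ : p^-1 * _ = l / (2 * p))//; field; lra.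
rewrite ler_wpDl ?expR_ge0// /N_young mulrCA ler_peMr ?powR_ge0//.
have pl0 : 0 < 2 * p / l by rewrite divr_gt0 ?mulr_gt0.
have ln0 : 0 <= ln (expR 1 + t).
  by apply: ln_ge0; have := expR_ge1Dx (1 : R); lra.
rewrite -powRM// ?(ltW pl0)//.
rewrite -[leLHS](congr1 (@^~ sigma) (powR1 R)).
apply: le_powR => //; first exact: ltW.
rewrite mulrC -ler_pdivrMr ?divr_gt0 ?mulr_gt0// div1r invf_div.
rewrite (le_trans (ltW lt))// ler_ln ?posrE ?addr_gt0 ?expR_gt0//.
by rewrite lerDr expR_ge0.
Qed.

Lemma expR_half_le l sigma : 0 < sigma -> 0 < l ->
  expR (- (l / 2)) <= (2 * sigma) `^ sigma * l `^ (- sigma).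
Proof.
move=> s0 l0; rewrite powRN -ler_pdivrMr ?invr_gt0 ?powR_gt0// invrK.
rewrite -ler_pdivlMl ?expR_gt0// -expRN opprK mulrC.
exact: powR_le_expR (ltW l0).
Qed.

(** Telescoping: with b = theta - 1, each term x^(-theta) with x >= 2 is at most ((x-1)^(-b) -
    x^(-b)) / b. *)
Lemma sum_powR_bounded theta : 1 < theta -> exists M : R, forall n : nat,
  \sum_(k < n) k.+1%:R `^ (- theta) <= M.
Proof.
move=> th1; pose b := theta - 1; have b0 : 0 < b by rewrite subr_gt0.
suff bound n : \sum_(k < n.+1) k.+1%:R `^ (- theta) <=
    1 + b^-1 * (1 - n.+1%:R `^ (- b)).
  exists (1 + b^-1) => -[|n]; first by rewrite big_ord0 addr_ge0// invr_ge0 ltW.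
  rewrite (le_trans (bound n))// lerD2l ler_piMr//.
    by rewrite invr_ge0 ltW.
elim: n => [|n IH]; first by rewrite big_ord1 !powR1 subrr mulr0 addr0.
rewrite big_ord_recr/= (le_trans (lerD IH (lexx _)))//.
rewrite -addrA lerD2l -lerBrDl -mulrBr mulrC -ler_pdivrMr ?invr_gt0// invrK.
set x : R := n.+2%:R; have x2 : 2 <= x by rewrite ler_nat.
have -> : (n.+1%:R : R) = x * (1 - x^-1).
  by rewrite mulrBr mulr1 divff ?gt_eqF// /x -[n.+2]addn1 natrD addrK.
rewrite powRM ?subr_ge0 ?invf_le1 ?(le_trans _ x2)//; last by lra.
have x1 : 0 < 1 - x^-1 by rewrite subr_gt0 invf_lt1; lra.
have x0 : 0 < x by lra.
have e : x `^ (- theta) = x `^ (- b) * x^-1.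
  rewrite -(@powR_inv1 _ x) ?ltW// -powRD; first by congr (_ `^ _); rewrite /b; lra.
  by rewrite (gt_eqF x0) implybT.
(* From 1 + z <= e^z at z = b/x, together with ln(1 - 1/x) <= -1/x. *)
have lb : 1 + b * x^-1 <= (1 - x^-1) `^ (- b).
  rewrite /powR gt_eqF// (le_trans (expR_ge1Dx _))// ler_expR mulNr -mulrN.
  apply: ler_wpM2l; first exact: ltW.
  rewrite lerNr.
  by have := @le_ln1Dx R (- x^-1); rewrite ltrN2 invf_lt1//; apply; lra.
have : x `^ (- b) * (1 + b * x^-1) <= x `^ (- b) * (1 - x^-1) `^ (- b).
  by rewrite ler_wpM2l ?powR_ge0.
rewrite e -subr_ge0 => h; rewrite -subr_ge0.
by rewrite [leRHS](_ : _ = x `^ (- b) * (1 - x^-1) `^ (- b) -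
  x `^ (- b) * (1 + b / x))//; ring.
Qed.

End real_inequalities.

(** * Square roots of nonnegative matrices *)

(** Newton's scheme: to reach a new node [a], add a multiple of [w], which vanishes at the old nodes
    but not at [a]. *)
Lemma exists_interpolation (F : fieldType) (f : F -> F) (s : seq F) :
  exists q : {poly F}, {in s, forall x, q.[x] = f x}.
Proof.
elim: s => [|a s [q qs]]; first by exists 0.
have [as_|as_] := boolP (a \in s).
  by exists q => x; rewrite inE => /predU1P[->|/qs//]; exact: qs.
pose w := \prod_(b <- s) ('X - b%:P).
have wa : w.[a] != 0.
  by rewrite -[_ == 0]/(root w a) root_prod_XsubC.
exists (q + ((f a - q.[a]) / w.[a]) *: w) => x.
rewrite inE !hornerE => /predU1P[->|xs]; first by rewrite divfK// addrC subrK.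
have /eqP -> : w.[x] == 0 by rewrite -[_ == 0]/(root w x) root_prod_XsubC.
by rewrite mulr0 addr0 qs.
Qed.

Lemma trmx_horner_mx (F : comNzRingType) (n : nat) (A : 'M[F]_n.+1) (q : {poly F}) :
  (horner_mx A q)^T = horner_mx A^T q.
Proof.
elim/poly_ind: q => [|q c IH]; first by rewrite !rmorph0 trmx0.
rewrite !rmorphD !rmorphM /= !horner_mx_C !horner_mx_X linearD /= tr_scalar_mx.
by rewrite -mulmxE trmx_mul IH mulmxE; congr (_ + _); apply: comm_mx_horner.
Qed.

Section dot.
Variables (R : realType) (n : nat).
Implicit Types (u w : 'cV[R]_n) (A : 'M[R]_n).

Lemma dotE u w : dot u w = (u^T *m w) ord0 ord0.
Proof. by rewrite /dot mxE; apply: eq_bigr => i _; rewrite mxE. Qed.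

Lemma dot_ge0 u : 0 <= dot u u.
Proof. by apply: sumr_ge0 => i _; rewrite -expr2 sqr_ge0. Qed.

Lemma dotC u w : dot u w = dot w u.
Proof. by apply: eq_bigr => i _; rewrite mulrC. Qed.

Lemma dotDl u1 u2 w : dot (u1 + u2) w = dot u1 w + dot u2 w.
Proof. by rewrite !dotE linearD /= mulmxDl mxE. Qed.

Lemma dotZl c u w : dot (c *: u) w = c * dot u w.
Proof. by rewrite !dotE linearZ /= -scalemxAl mxE. Qed.

Lemma dot_mulmxr A u w : dot u (A *m w) = dot (A^T *m u) w.
Proof. by rewrite !dotE trmx_mul trmxK mulmxA. Qed.

Lemma dot_eq0 u : dot u u = 0 -> u = 0.
Proof.
move=> /eqP; rewrite psumr_eq0 => [/allP h|i _]; last by rewrite -expr2 sqr_ge0.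
apply/matrixP => i j; rewrite ord1 mxE.
by have := h i (mem_index_enum _); rewrite /= mulf_eq0 orbb => /eqP.
Qed.

End dot.

Section sqrtmx.
Variables (R : realType) (n : nat).
Implicit Types (Q : 'M[R]_n.+1).

Lemma nonneg_definite_eigenvalue Q a : Q^T = Q -> nonneg_definite Q ->
  eigenvalue Q a -> 0 <= a.
Proof.
move=> Qs Q0 /eigenvalueP[w wQ w0].
have := Q0 w^T; rewrite -{1}Qs -trmx_mul wQ linearZ /= dotC dotZl.
rewrite pmulr_lge0// lt_neqAle dot_ge0 andbT eq_sym.
by apply: contra_neq w0 => /dot_eq0 w0; rewrite -[w]trmxK w0 trmx0.
Qed.

(* Diagonalise over the complex numbers; the eigenvalues are real, so that a
   real interpolation polynomial for the fourth root can be applied to [Q]. *)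
Lemma exists_sqrtmx Q : Q^T = Q -> nonneg_definite Q ->
  exists S : 'M[R]_n.+1, [/\ S^T = S, nonneg_definite S & S *m S = Q].
Proof.
move=> Qs Q0; pose toC := real_complex R; pose A := map_mx toC Q.
have Ah : A \is hermsymmx.
  apply: realsym_hermsym.
    by apply/is_hermitianmxP; rewrite expr0 scale1r map_mx_id// /A map_trmx Qs.
  by apply/mxOverP => i j; rewrite mxE; apply/complex_realP; exists (Q i j).
have [P [d [Pu dreal AE]]] : exists (P : 'M[complex R]_n.+1) (d : 'rV[complex R]_n.+1),
    [/\ P \in unitmx, forall i, d ord0 i \is Num.real
      & A = invmx P *m diag_mx d *m P].
  exists (spectralmx A), (spectral_diag A); split.
  - exact: spectral_unit.
  - by move=> i; have /mxOverP := hermitian_spectral_diag_real Ah; exact.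
  - exact/orthomx_spectralP/hermitian_normalmx.
pose k i := complex.Re (d ord0 i).
have dk i : d ord0 i = toC (k i) by rewrite /toC RRe_real.
have k0 i : 0 <= k i.
  (* Eigenvalues are read off the characteristic polynomial, which is the same over the reals and
     over the complex numbers; row [i] of [P] is an eigenvector over the latter. *)
  apply: (nonneg_definite_eigenvalue Qs Q0).
  rewrite eigenvalue_root_char -(fmorph_root toC) map_char_poly -/A.
  rewrite -eigenvalue_root_char; apply/eigenvalueP; exists (row i P).
    rewrite {1}AE !mulmxA -row_mul mulmxV// row1.
    rewrite -[delta_mx _ _]/(delta_mx 0 i) -rowE row_diag_mx -scalemxAl -rowE.
    by rewrite dk.
  apply: contraTneq Pu => P0; apply/negP => Pu.
  have := congr1 (fun X => row i X) (mulmxV Pu); rewrite row_mul P0 mul0mx.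
  by move=> /rowP/(_ i)/eqP; rewrite !mxE eqxx eq_sym oner_eq0.
have [q qk] := @exists_interpolation _ (fun x => Num.sqrt (Num.sqrt x))
  [seq k i | i : 'I_n.+1].
have {}qk i : q.[k i] = Num.sqrt (Num.sqrt (k i)).
  by apply: qk; apply/mapP; exists i => //; rewrite mem_enum.
pose T := horner_mx Q q.
(* [T] is a symmetric fourth root of [Q], so that its square is a square root of [Q], nonnegative
   because the quadratic form of [T *m T] at [w] is |T w|^2. *)
have Ts : T^T = T by rewrite /T trmx_horner_mx Qs.
exists (T *m T); split.
- by rewrite trmx_mul Ts.
- by move=> w; rewrite -mulmxA dot_mulmxr Ts dot_ge0.
- have -> : T *m T *m (T *m T) = horner_mx Q (q ^+ 4).
    by rewrite rmorphXn /= !mulmxE !exprS expr0 mulr1 !mulrA.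
  have dE : horner_mx (diag_mx d) (map_poly toC (q ^+ 4)) = diag_mx d.
    rewrite horner_mx_diag; congr diag_mx.
    apply/rowP => i; rewrite !mxE dk horner_map /= hornerE qk.
    by rewrite (exprM _ 2 2) !sqr_sqrtr// sqrtr_ge0.
  apply: (map_mx_inj (f := toC)); rewrite map_horner_mx -/A.
  by rewrite {1}AE horner_mx_uconjC ?dE -?AE.
Qed.

(** The existence of a root excludes the default value 0 of [sqrtmx]. The right-hand side no longer
    mentions the choice of the root, which gives access to measurability in x. *)
Lemma enorm_sqrtmx Q w : Q^T = Q -> nonneg_definite Q ->
  enorm (sqrtmx Q *m w) = Num.sqrt (dot w (Q *m w)).
Proof.
move=> Qs Q0; rewrite /enorm /sqrtmx.
case: xgetP => [S _ /= [Ss _ SS]|noS].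
  by rewrite dot_mulmxr Ss dotC mulmxA SS.
by have [S /noS] := exists_sqrtmx Qs Q0.
Qed.

End sqrtmx.

(** * Measurability of open sets and of partial derivatives *)

Section lebesgue_open.
Variables (R : realType) (n : nat).
Local Notation E := 'rV[R]_n.+1.
Implicit Types (a b x : E) (c : R) (i : 'I_n.+1).

Let upd x i c : E := \row_j (if j == i then c else x ord0 j).

(** With [Num.min] and [Num.max] the identity also covers a hyperplane that misses the box: one of
    the pieces then has volume 0. *)
Lemma box_vol_split a b i c :
  box_vol a (upd b i (Num.min (b ord0 i) c)) +
  box_vol (upd a i (Num.max (a ord0 i) c)) b = box_vol a b.
Proof.
rewrite /box_vol (bigD1 i)//= [X in _ + X](bigD1 i)//= [RHS](bigD1 i)//= !mxE eqxx.
under eq_bigr => j ji do rewrite mxE (negbTE ji).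
under [X in _ + _ * X]eq_bigr => j ji do rewrite mxE (negbTE ji).
rewrite -mulrDl; congr (_ * _).
rewrite /Num.max /Num.min; repeat case: ifPn; rewrite -?leNgt; lra.
Qed.

(** Caratheodory's criterion: cut every box of a covering of [X] along the hyperplane; the two
    families cover the two parts of [X], and their volumes add up to the original ones. *)
Lemma measurable_halfspace i c : measurable [set x : E | x ord0 i <= c].
Proof.
apply: (@le_caratheodory_measurable R _ (@leb_outer R n)) => X.
apply: le_ereal_inf_tmp => _ [ab Xab <-].
pose l k := box_vol (ab k).1 (upd (ab k).2 i (Num.min ((ab k).2 ord0 i) c)).
pose r k := box_vol (upd (ab k).1 i (Num.max ((ab k).1 ord0 i) c)) (ab k).2.
have -> : (\sum_(k <oo) (box_vol (ab k).1 (ab k).2)%:E =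
    \sum_(k <oo) (l k)%:E + \sum_(k <oo) (r k)%:E)%E.
  rewrite -nneseriesD; try by move=> *; exact: box_vol_ge0.
  by apply: eq_eseriesr => k _; rewrite -EFinD box_vol_split.
apply: leeD; apply: ereal_inf_lbound.
- exists (fun k => ((ab k).1, upd (ab k).2 i (Num.min ((ab k).2 ord0 i) c))) => //.
  move=> x [/Xab[k _ xk] /= xc]; exists k => // j; rewrite mxE.
  by have := xk j; case: eqP => // -> /andP[-> ?]; rewrite le_min xc andbT.
- exists (fun k => (upd (ab k).1 i (Num.max ((ab k).1 ord0 i) c), (ab k).2)) => //.
  move=> x [/Xab[k _ xk] /= /negP xc]; exists k => // j; rewrite mxE.
  have := xk j; case: eqP => // -> /andP[ai ->]; rewrite andbT gt_max ai.
  by case: leP xc.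
Qed.

Lemma measurable_box a b : measurable (box a b).
Proof.
have -> : box a b = \bigcap_(i in [set: 'I_n.+1])
    (~` [set x : E | x ord0 i <= a ord0 i] `&` [set x : E | x ord0 i <= b ord0 i]).
  apply/seteqP; split=> [x xab i _|x xab i] /=.
    by have /andP[ax bx] := xab i; split=> //; rewrite leNgt ax.
  by have [/negP] := xab i I; rewrite -ltNge => -> ->.
apply: fin_bigcap_measurable => // i _.
apply: measurableI; last exact: measurable_halfspace.
by apply: measurableC; exact: measurable_halfspace.
Qed.

Lemma measurable_open (U : set E) : open U -> measurable U.
Proof.
move=> oU; pose q (y : 'rV[rat]_n.+1) : E := map_mx ratr y.
(* The inclusion does not involve the point: [F yz] is the whole rational box if that lies in [U]
   and is empty otherwise, so that [U] becomes a countable union of boxes. *)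
pose F (yz : 'rV[rat]_n.+1 * 'rV[rat]_n.+1) : set E :=
  [set x | box (q yz.1) (q yz.2) `<=` U /\ box (q yz.1) (q yz.2) x].
have -> : U = \bigcup_yz F yz.
  apply/seteqP; split => [x Ux|x [yz _ [/[apply]]]//].
  have /nbhs_ballP[e /= e0 eU] := open_nbhs_nbhs (conj oU Ux).
  have hq (s t : R) : s < t -> exists y, s < ratr y < t.
    by move=> /rat_in_itvoo[y]; rewrite in_itv; exists y.
  have xe i : x ord0 i - e < x ord0 i by rewrite ltrBlDr ltrDl.
  have xe' i : x ord0 i < x ord0 i + e by rewrite ltrDl.
  have [y yP] := choice (fun i => hq _ _ (xe i)).
  have [z zP] := choice (fun i => hq _ _ (xe' i)).
  exists (\row_i y i, \row_i z i) => //; split.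
    move=> w wyz; apply: eU; rewrite mx_norm_ball /ball_ /=.
    rewrite /Num.norm /= mx_normrE; apply/bigmax_ltP; split => // -[i j] _ /=.
    rewrite !mxE ord1 ltr_distl.
    have := wyz j; rewrite !mxE => /andP[w1 w2].
    have := yP j; have := zP j; move: w1 w2 => /=; lra.
  move=> i /=; rewrite !mxE.
  by have /andP[_ ->] := yP i; have /andP[/ltW ->] := zP i.
apply: countable_bigcupT_measurable; first exact: countableP.
move=> yz; rewrite /F; have [yzU|yzU] := pselect (box (q yz.1) (q yz.2) `<=` U).
  rewrite [X in measurable X](_ : _ = box (q yz.1) (q yz.2)).
    exact: measurable_box.
  by apply/seteqP; split => x // [].
rewrite [X in measurable X](_ : _ = set0) //.
by apply/seteqP; split => x // [].
Qed.

Lemma continuous_measurable (phi : E -> R) :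
  continuous phi -> measurable_fun setT phi.
Proof.
move=> /continuousP cphi.
apply: (measurability _ (RGenOInfty.measurableE R)).
move=> _ [_ [y ->] <-]; rewrite setTI; apply: measurable_open.
by apply: cphi; exact: rray_open.
Qed.

End lebesgue_open.

Section directional_derivative.
Variables (R : realType) (n : nat).
Local Notation E := 'rV[R]_n.+1.
Implicit Types (phi : E -> R) (w x : E).

Let quot phi w x (h : R) : R := h^-1 * ((phi \o shift x) (h *: w) - phi x).

Let quot_continuous phi w h : continuous phi -> continuous (quot phi w ^~ h).
Proof.
move=> cphi x.
have cx : {for x, continuous (fun x => h *: w + x)}.
  exact: (@cvgD _ _ _ (nbhs x) (nbhs_filter x) _ _ _ _ (cvg_cst _) cvg_id).
have cq := @cvgB _ _ _ (nbhs x) (nbhs_filter x) _ _ _ _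
  (continuous_comp cx (cphi _)) (cphi x).
exact: (@cvgM _ _ (nbhs x) (nbhs_filter x) _ _ _ _ (cvg_cst _) cq).
Qed.

(* Derivability is the Cauchy criterion for the difference quotients.  The centres
   can be taken rational, and for each of them the points at which the criterion
   fails form an open set, whatever the increments [h]. *)
Lemma measurable_derivable phi w : continuous phi ->
  measurable [set x | derivable phi x w].
Proof.
move=> cphi.
pose U k (c : rat) (m : nat) : set E :=
  \bigcup_(h in [set h : R | 0 < `|h| < m.+1%:R^-1])
    [set x | k.+1%:R^-1 < `|quot phi w x h - ratr c|].
have -> : [set x | derivable phi x w] =
    \bigcap_k \bigcup_c \bigcup_m ~` U k c m.
  apply/seteqP; split => x /= => [dx k _|xU].
    have k0 : 0 < k.+1%:R^-1 / 2 :> R by [].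
    pose d : R := 'D_w phi x; pose e2 : R := k.+1%:R^-1 / 2.
    have [c /andP[c1 c2]] : exists c : rat, d - e2 < ratr c < d + e2.
      have /rat_in_itvoo[c] : d - e2 < d + e2 by rewrite -/e2 in k0; lra.
      by rewrite in_itv; exists c.
    exists c => //.
    have /cvgrPdist_lt/(_ _ k0) := dx.
    rewrite nbhs_simpl /= => /nbhs_ballP[e /= e0 he].
    have [m me] : exists m : nat, m.+1%:R^-1 < e.
      have [m _ /(_ m (leqnn m)) me] := near_infty_natSinv_lt (PosNum e0).
      by exists m.
    exists m => // -[h /andP[h0 hm] /=]; apply/negP; rewrite -leNgt.
    have := he h; rewrite /ball /= sub0r normrN => /(_ (lt_trans hm me)).
    rewrite -normr_gt0 => /(_ h0) qh.
    have {}qh : `|d - quot phi w x h| < e2 by exact: qh.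
    have -> : k.+1%:R^-1 = e2 + e2 by rewrite /e2 -splitr.
    apply/ltW; move: qh; rewrite !ltr_norml => /andP[q1 q2].
    by apply/andP; split; lra.
  apply/cauchy_cvgP/cauchyP => e e0.
  have [k ke] : exists k : nat, k.+1%:R^-1 < e.
    have [m _ /(_ m (leqnn m)) me] := near_infty_natSinv_lt (PosNum e0).
    by exists m.
  have [c _ [m _ xm]] := xU k I; exists (ratr c).
  have m0 : 0 < m.+1%:R^-1 :> R by [].
  suff : \forall h \near (0 : R)^', `|ratr c - quot phi w x h| < e by [].
  near=> h.
  rewrite (le_lt_trans _ ke)// distrC leNgt; apply/negP => hk.
  apply: xm; exists h => //=; rewrite normr_gt0; apply/andP; split.
    by near: h; exact: nbhs_dnbhs_neq.
  by near: h; exact: dnbhs0_lt.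
apply: bigcapT_measurable => k; apply: bigcupT_measurable_rat => c.
apply: bigcupT_measurable => m; apply: measurableC; apply: measurable_open.
apply: bigcup_open => h _.
apply: (@open_comp _ _ (fun x => `|quot phi w x h - ratr c|)
  [set y | k.+1%:R^-1 < y]); last exact: open_gt.
move=> x _; apply: (@cvg_norm _ _ _ (nbhs x) (nbhs_filter x)).
apply: (@cvgB _ _ _ (nbhs x) (nbhs_filter x)); first exact: quot_continuous.
exact: cvg_cst.
Unshelve. all: by end_near. Qed.

(** ['D_w] is a [lim], whose default value for a divergent filter is the point 0. *)
Lemma derive_not_derivable phi w x : ~ derivable phi x w -> 'D_w phi x = 0.
Proof. by move=> nd; rewrite /derive dvgP. Qed.

(** The derivative is the pointwise limit of the difference quotients with increment 1/(m+1), cut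
    off by the indicator of the points of derivability; elsewhere limit and derivative are both
    0. *)
Lemma measurable_derive phi w : continuous phi ->
  measurable_fun setT (fun x => 'D_w phi x).
Proof.
move=> cphi.
pose D := [set x | derivable phi x w].
apply: (@measurable_fun_cvg _ _ _ _
  (fun m x => \1_D x * quot phi w x m.+1%:R^-1)) => [m|x _].
  apply: measurable_funM; last exact/continuous_measurable/quot_continuous.
  exact/measurable_indic/measurable_derivable.
have [Dx|nDx] := pselect (derivable phi x w).
  rewrite indicE mem_set//.
  under eq_fun do rewrite mul1r.
  apply: (@cvg_comp _ _ _ _ (quot phi w x) _ ((0 : R)^')); last exact: Dx.
  move=> A A0.
  have : \forall m \near \oo, (@harmonic R) m != 0 -> A (harmonic m).
    exact: (@cvg_harmonic R _ A0).
  by apply: filterS => m; apply; rewrite gt_eqF// harmonic_gt0.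
rewrite derive_not_derivable// indicE memNset//.
by under eq_fun do rewrite mul0r; exact: cvg_cst.
Qed.

End directional_derivative.

(** * Truncations of Lipschitz functions *)

Section truncation.
Variables (R : realType) (n : nat).
Local Notation E := 'rV[R]_n.+1.
Implicit Types (Omega : set E) (phi : E -> R) (r : R) (x w : E).

Definition trunc r phi x : R := Num.max (phi x - r) 0.

Lemma trunc_ge0 r phi x : 0 <= trunc r phi x.
Proof. by rewrite /trunc le_max lexx orbT. Qed.

Lemma lipschitz_continuous_at phi x :
  (exists2 U : set E, nbhs x U & [lipschitz phi y | y in U]) ->
  {for x, continuous phi}.
Proof.
move=> [U xU [M [_ /(_ (Num.max M 0 + 1))]]].
(* The Lipschitz bound is available for all constants beyond [M]; this one is moreover positive. *)
set K := _ + 1 => KP.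
have K0 : 0 < K by rewrite ltr_wpDl// le_max lexx orbT.
have {}KP y : U y -> `|phi x - phi y| <= K * `|x - y|.
  move=> Uy; apply: (KP _ (x, y)) => //=.
    by rewrite (@le_lt_trans _ _ (Num.max M 0)) ?le_max ?lexx// ltrDl.
  by split => //; exact: nbhs_singleton.
apply/(@cvgrPdist_lt _ _ _ (nbhs x) (nbhs_filter x)) => e e0.
have ye : nbhs x (ball x (e / K)) by apply: nbhsx_ballx; rewrite divr_gt0.
apply: (@filterS2 _ (nbhs x) (nbhs_filter x) _ _ _ _ xU ye) => y Uy.
rewrite mx_norm_ball /ball_ /= => xy.
by rewrite (le_lt_trans (KP y _))// mulrC -ltr_pdivlMr.
Qed.

(** Outside [Omega] the Lipschitz condition says nothing, but there a point has a neighbourhood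
    missing the closed support, on which [phi] is 0. *)
Lemma Lip0_continuous Omega phi : Lip0 Omega phi -> continuous phi.
Proof.
move=> [lip _ suppO] x; have [/lip|Ox] := pselect (Omega x).
  exact: lipschitz_continuous_at.
have xs : nbhs x (~` closure [set x | phi x != 0]).
  apply: open_nbhs_nbhs; split; first exact/closed_openC/closed_closure.
  by move/suppO.
have phi0 y : (~` closure [set x | phi x != 0]) y -> phi y = 0.
  by move=> ys; apply: contra_notP ys => /eqP ys; apply: subset_closure.
rewrite /prop_for /continuous_at (phi0 _ (nbhs_singleton xs)).
apply: (@cvg_near_cst _ _ 0 phi (nbhs x) (nbhs_filter x)).
by apply: (@filterS _ (nbhs x) (nbhs_filter x) _ _ _ xs) => y /phi0.
Qed.

(** As r >= 0, the truncation vanishes where [phi] does, so the support does not grow; and t |->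
    max(t - r, 0) preserves local Lipschitz constants. *)
Lemma Lip0_trunc Omega phi r : 0 <= r -> Lip0 Omega phi ->
  Lip0 Omega (trunc r phi).
Proof.
move=> r0 [lip cphi phiO].
have sub : closure [set x | trunc r phi x != 0] `<=` closure [set x | phi x != 0].
  apply: closureS => x; apply: contra_neq => /= phi0.
  by rewrite /trunc phi0 sub0r max_r// oppr_le0.
split.
- move=> x /lip[U xU UP]; exists U => //.
  move: UP; rewrite /lipschitz_on; apply: filterS => M MP y Uy.
  rewrite /= (le_trans _ (MP y Uy))//.
  rewrite /trunc /Num.max; case: y Uy => y1 y2 _ /=.
  have := ler_norm (phi y1 - phi y2).
  have := ler_norm (phi y2 - phi y1); rewrite distrC.
  by rewrite ler_norml; case: ifPn; case: ifPn; rewrite -?leNgt; lra.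
- exact: subclosed_compact (@closed_closure _ _) cphi sub.
- exact: subset_trans sub phiO.
Qed.

(** At a minimum with value 0 a nonzero difference quotient has the sign of its increment. Were the
    derivative L nonzero, all quotients within |L| of L would have the sign of L; an increment of
    the opposite sign contradicts this. *)
Lemma derive_at_min0 (f : E -> R) w x :
  (forall y, 0 <= f y) -> f x = 0 -> 'D_w f x = 0.
Proof.
move=> f0 fx; have [d|] := pselect (derivable f x w); last first.
  exact: derive_not_derivable.
pose L : R := 'D_w f x; apply/eqP; apply: contraT => L0.
have {}L0 : 0 < `|L| by rewrite normr_gt0.
have /cvgrPdist_lt/(_ _ L0) := d.
rewrite nbhs_simpl /= => /nbhs_ballP[e /= e0 he].
have {}he h : h != 0 -> `|h| < e -> `|L - h^-1 * f (h *: w + x)| < `|L|.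
  move=> h0 hle; have := he h; rewrite /ball /= sub0r normrN => /(_ hle h0) hq.
  have : `|L - h^-1 * (f (h *: w + x) - f x)| < `|L| by exact: hq.
  by rewrite fx subr0.
have e20 : 0 < e / 2 by rewrite divr_gt0.
have ne2 : `|e / 2| < e by rewrite gtr0_norm//; lra.
have [Lpos|Lneg] := leP 0 L.
- have := he (- (e / 2)); rewrite normrN oppr_eq0 gt_eqF// => /(_ isT ne2).
  rewrite invrN mulNr opprK ger0_norm; last first.
    by rewrite addr_ge0// mulr_ge0// invr_ge0 ltW.
  by rewrite ger0_norm// gtrDl ltNge mulr_ge0// invr_ge0 ltW.
- have := he (e / 2); rewrite gt_eqF// => /(_ isT ne2).
  have ? : 0 <= (e / 2)^-1 * f (e / 2 *: w + x).
    by rewrite mulr_ge0// invr_ge0 ltW.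
  by rewrite ltr0_norm ?ltr0_norm; lra.
Qed.

(* At the points where [phi x = r] the truncation has a minimum, hence a vanishing
   derivative or none at all; in the latter case ['D_w] takes its default value 0. *)
Lemma derive_trunc r phi w x : {for x, continuous phi} ->
  'D_w (trunc r phi) x = if r < phi x then 'D_w phi x else 0.
Proof.
move=> cphi; case: ltgtP => [rx|rx|rx].
- rewrite (@near_eq_derive _ _ _ _ (phi - cst r)).
    have [dphi|ndphi] := pselect (derivable phi x w).
      by rewrite (deriveB dphi (derivable_cst r x w)) derive_cst subr0.
    (* Derivability passes between [phi] and [phi - r]; where it fails, both sides take the default
       0. *)
    rewrite (derive_not_derivable ndphi); apply: derive_not_derivable => d.
    apply: ndphi; rewrite -(subrK (cst r) phi).
    exact: (derivableD d (derivable_cst r x w)).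
  have := @cvgr_gt _ _ (nbhs x) (nbhs_filter x) _ _ cphi _ rx.
  by apply: (@filterS _ (nbhs x) (nbhs_filter x)) => y ry; rewrite /trunc max_l// subr_ge0 ltW.
- rewrite (@near_eq_derive _ _ _ _ (cst 0)) ?derive_cst//.
  have := @cvgr_lt _ _ (nbhs x) (nbhs_filter x) _ _ cphi _ rx.
  by apply: (@filterS _ (nbhs x) (nbhs_filter x)) => y ry; rewrite /trunc max_r// subr_le0 ltW.
- apply: derive_at_min0 => [y|]; first exact: trunc_ge0.
  by rewrite /trunc -rx subrr maxxx.
Qed.

Lemma grad_trunc r phi x : {for x, continuous phi} ->
  grad (trunc r phi) x = if r < phi x then grad phi x else 0.
Proof.
move=> cphi; apply/colP => i; rewrite !mxE derive_trunc//.
by case: ifP => _; rewrite mxE.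
Qed.

End truncation.

(** * The seminorm defined by the matrix function *)

Section euclidean.
Variables (R : realType) (n : nat).
Implicit Types (a b w : 'cV[R]_n).

Lemma enorm_ge0 a : 0 <= enorm a.
Proof. exact: sqrtr_ge0. Qed.

Lemma sqr_enorm a : enorm a ^+ 2 = dot a a.
Proof. by rewrite sqr_sqrtr// dot_ge0. Qed.

Lemma dotBl a b w : dot (a - b) w = dot a w - dot b w.
Proof. by rewrite -[- b]scaleN1r dotDl dotZl mulN1r. Qed.

Lemma dotDr a b w : dot w (a + b) = dot w a + dot w b.
Proof. by rewrite dotC dotDl !(dotC w). Qed.

Lemma dot0l w : dot 0 w = 0.
Proof. by rewrite -(scale0r 0) dotZl mul0r. Qed.

Lemma cauchy_schwarz a b : `|dot a b| <= enorm a * enorm b.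
Proof.
rewrite -ler_sqr ?nnegrE ?mulr_ge0 ?enorm_ge0// exprMn !sqr_enorm real_normK ?num_real//.
have [b0|b0] := eqVneq (dot b b) 0.
  by rewrite (dot_eq0 b0) dotC dot0l expr0n/= dot0l mulr0.
have bp : 0 < dot b b by rewrite lt_neqAle eq_sym b0 dot_ge0.
(* The square norm of this vector is (b.b) ((a.a)(b.b) - (a.b)^2). *)
have := dot_ge0 (dot b b *: a - dot a b *: b).
rewrite dotBl !dotZl ![dot _ (_ - _)]dotC !dotBl !dotZl [dot b a]dotC => h.
rewrite -subr_ge0 -(pmulr_rge0 _ bp) (le_trans h)// le_eqVlt; apply/orP; left.
by apply/eqP; ring.
Qed.

Lemma enormD_le a b : enorm (a + b) <= enorm a + enorm b.
Proof.
rewrite -ler_sqr ?nnegrE ?addr_ge0 ?enorm_ge0// sqr_enorm sqrrD !sqr_enorm.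
rewrite dotDl !dotDr [dot b a]dotC.
have := le_trans (ler_norm _) (cauchy_schwarz a b); lra.
Qed.

End euclidean.

Lemma dot_sqrtmx (R : realType) (n : nat) (Q : 'M[R]_n.+1) a b :
  Q^T = Q -> nonneg_definite Q ->
  dot (sqrtmx Q *m a) (sqrtmx Q *m b) = dot a (Q *m b).
Proof.
move=> Qs Q0; rewrite /sqrtmx; case: xgetP => [S _ /= [Ss _ SS]|noS].
  by rewrite -[in RHS]SS -mulmxA [RHS]dot_mulmxr Ss.
by have [S /noS] := exists_sqrtmx Qs Q0.
Qed.

(** * Real-valued integrals over the domain *)

Section integrals.
Variables (R : realType) (n : nat) (Omega : set 'rV[R]_n.+1).
Hypothesis mO : measurable Omega.
Local Notation E := 'rV[R]_n.+1.
Local Notation mu := (leb R n).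
Local Notation itg h := (mu.-integrable Omega (EFin \o h)).
Local Notation J h := (\int[mu]_(x in Omega) h x).
Implicit Types (h k : E -> R).

Lemma ge0_integrable h : measurable_fun Omega h ->
  (forall x, Omega x -> 0 <= h x) ->
  (\int[mu]_(x in Omega) (h x)%:E < +oo)%E -> itg h.
Proof.
move=> mh h0 hoo; apply/integrableP; split; first exact/measurable_EFinP.
rewrite (_ : (\int[mu]_(x in Omega) _)%E = (\int[mu]_(x in Omega) (h x)%:E)%E)//.
by apply: eq_integral => x; rewrite inE => /h0 hx /=; rewrite ger0_norm.
Qed.

Lemma le_integrable_real h k : measurable_fun Omega h -> itg k ->
  (forall x, Omega x -> `|h x| <= k x) -> itg h.
Proof.
move=> mh ik hk; apply: (le_integrable mO _ _ ik); first exact/measurable_EFinP.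
by move=> x Ox /=; rewrite lee_fin (le_trans (hk x Ox))// ler_norm.
Qed.

Lemma EFin_Rintegral h : itg h -> (J h)%:E = (\int[mu]_(x in Omega) (h x)%:E)%E.
Proof. by move=> ih; rewrite fineK//; exact: integrable_fin_num. Qed.

Lemma integrable_lin (a b : R) h k : itg h -> itg k ->
  itg (fun x => a * h x + b * k x).
Proof.
move=> ih ik.
by apply: (integrableD mO (integrableZl mO a ih) (integrableZl mO b ik)).
Qed.

Lemma Rintegral_lin (a b : R) h k : itg h -> itg k ->
  J (fun x => a * h x + b * k x) = a * J h + b * J k.
Proof.
move=> ih ik; rewrite RintegralD// ?RintegralZl//.
  exact: (integrableZl mO a ih).
exact: (integrableZl mO b ik).
Qed.

Lemma integrable_scale (a : R) h : itg h -> itg (fun x => a * h x).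
Proof. by move=> ih; exact: (integrableZl mO a ih). Qed.

Lemma measurable_gt (r : R) h : measurable_fun Omega h ->
  measurable_fun Omega (fun x => (r < h x)%R%:R : R).
Proof.
move=> mh.
have mb : measurable_fun Omega (fun x => (r < h x)%R) by exact: measurable_fun_ltr.
have mn : measurable_fun setT (fun b : bool => b%:R : R) by [].
exact: (measurableT_comp mn mb).
Qed.

Lemma measurable_powR_fun q h : measurable_fun Omega h ->
  measurable_fun Omega (fun x => h x `^ q).
Proof. by move=> mh; exact: (measurableT_comp (measurable_powR q) mh). Qed.

Lemma measurable_norm_fun h : measurable_fun Omega h ->
  measurable_fun Omega (fun x => `|h x|).
Proof. by move=> mh; exact: (measurableT_comp (@normr_measurable _ setT) mh). Qed.

End integrals.

(** * The estimate between two levels *)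

Section absorption.
Variables (R : realType) (p sigma alpha S B1 B2 B3 K : R).
Hypotheses (p1 : 1 < p) (sigma0 : 0 < sigma).
Hypotheses (S1 : 1 <= S) (K0 : 0 < K).
Hypotheses (B10 : 0 < B1) (B20 : 0 < B2) (B30 : 0 < B3).

Let B := B1 * S `^ p * K.

Let S0 : 0 < S.
Proof. by rewrite (lt_le_trans _ S1). Qed.

Let B0 : 0 < B.
Proof. by rewrite !mulr_gt0// powR_gt0. Qed.

Definition absorb_cst : R :=
  (2 * B) `^ (p / (p - 1)) * B2 + 2 * B1 * S `^ p * B3.

(** Scalar core of the level estimate: X stands for int phi^p dmu, G for the gradient energy of phi,
    F1 for int |f|^(p-1) phi dmu, Fp for int |f|^p dmu over the level set, eps for the gradient
    error. The hypotheses chain to a bound of X by l^(-sigma) F1 and eps, and Young's inequality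
    lets X be absorbed. *)
Lemma absorption (X G F1 Fp eps lam l : R) :
  0 <= X -> 0 <= eps -> 0 <= lam -> 1 <= l ->
  G <= K * F1 + B3 * eps ->
  X <= B1 * l `^ (- sigma) * (S `^ p * G) ->
  (forall tau, 0 < tau -> F1 <= tau * X + tau^-1 `^ (p - 1)^-1 * Fp) ->
  Fp <= B2 * lam `^ p * l `^ (p / alpha) * expR (- l) ->
  X <= absorb_cst *
    (lam `^ p * l `^ (p / alpha - sigma * p / (p - 1)) * expR (- l) + eps).
Proof.
move=> X0 eps0 lam0 l1 hG hX hF hFp.
have l0 : 0 < l by lra.
have p10 : 0 < p - 1 by rewrite subr_gt0.
pose ls := l `^ (- sigma); have ls0 : 0 < ls by rewrite powR_gt0.
have ls1 : ls <= 1.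
  by rewrite -[leRHS](powRr0 l); apply: ler_powR => //; rewrite oppr_le0 ltW.
have Sp0 : 0 < S `^ p by rewrite powR_gt0.
have [B1n B2n B3n] : [/\ 0 <= B1, 0 <= B2 & 0 <= B3] by split; exact: ltW.
have [Spn lsn Bn] : [/\ 0 <= S `^ p, 0 <= ls & 0 <= B] by split; exact: ltW.
have Kn := ltW K0.
(* With this value the coefficient of X after Young's inequality is exactly 1/2. *)
pose tau := (2 * B * ls)^-1.
have tau0 : 0 < tau by rewrite invr_gt0 !mulr_gt0.
have hF1 := hF _ tau0.
pose q := p / (p - 1).
(* The exponent 1 + 1/(p-1) is the conjugate exponent q = p/(p-1): the Sobolev gain l^(-sigma) is
   amplified to l^(-sigma q). *)
have tq : tau^-1 * tau^-1 `^ (p - 1)^-1 = (2 * B) `^ q * l `^ (- (sigma * q)).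
  have t0 : 0 < tau^-1 by rewrite invr_gt0.
  rewrite -{1}(@powRr1 _ tau^-1) ?ltW// -powRD; last first.
    by rewrite (gt_eqF t0) implybT.
  rewrite (_ : 1 + _ = q); last by rewrite /q; field; rewrite gt_eqF.
  rewrite /tau invrK powRM ?mulr_ge0//.
  by rewrite /ls -powRrM mulNr.
have XB : X <= B * ls * F1 + B1 * S `^ p * B3 * eps.
  rewrite (le_trans hX)// -/ls.
  have -> : B1 * ls * (S `^ p * G) = B1 * S `^ p * ls * G by ring.
  have c0 : 0 <= B1 * S `^ p * ls by rewrite !mulr_ge0.
  rewrite (le_trans (ler_wpM2l c0 hG))// /B mulrDr.
  have e1 : B1 * S `^ p * ls * (B3 * eps) <= B1 * S `^ p * B3 * eps.
    rewrite (_ : _ * (B3 * eps) = B1 * S `^ p * B3 * eps * ls); last by ring.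
    by rewrite ler_piMr// !mulr_ge0.
  rewrite (_ : B1 * S `^ p * ls * (K * F1) = B1 * S `^ p * K * ls * F1).
    by rewrite lerD2l.
  by ring.
have Bt : B * ls * tau = 2^-1.
  by rewrite /tau; field; rewrite !gt_eqF.
have XX : X <= 2^-1 * X + 2^-1 * (tau^-1 * tau^-1 `^ (p - 1)^-1 * Fp) +
    B1 * S `^ p * B3 * eps.
  rewrite (le_trans XB)// lerD2r.
  have bl0 : 0 <= B * ls by rewrite mulr_ge0.
  rewrite (le_trans (ler_wpM2l bl0 hF1))// mulrDr !mulrA Bt lerD2l.
  by rewrite -{1}[B * ls](@mulfK _ tau) ?gt_eqF// Bt lexx.
rewrite tq in XX.
have hFq := ler_wpM2l (mulr_ge0 (powR_ge0 (2 * B) q) (powR_ge0 l (- (sigma * q)))) hFp.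
have ll : l `^ (- (sigma * q)) * l `^ (p / alpha) =
    l `^ (p / alpha - sigma * p / (p - 1)).
  rewrite -powRD; last by rewrite (gt_eqF l0) implybT.
  by congr (_ `^ _); rewrite /q; ring.
rewrite (_ : _ * (B2 * _ * _ * _) = (2 * B) `^ q * B2 *
  (lam `^ p * l `^ (p / alpha - sigma * p / (p - 1)) * expR (- l))) in hFq; last first.
  by rewrite -ll; ring.
set M := lam `^ p * _ * _ in hFq *.
have M0 : 0 <= M by rewrite !mulr_ge0 ?powR_ge0 ?expR_ge0.
have c1 : 0 <= (2 * B) `^ q * B2 * eps.
  by rewrite !mulr_ge0 ?powR_ge0.
have c2 : 0 <= 2 * B1 * S `^ p * B3 * M.
  by rewrite mulr_ge0// !mulr_ge0.
have XM : X <= (2 * B) `^ q * B2 * M + 2 * (B1 * S `^ p * B3 * eps).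
  move: XX hFq; set T := _ * Fp; set U := _ * M; set V := _ * eps.
  by move=> ? ?; lra.
rewrite (le_trans XM)// -subr_ge0 /absorb_cst -/q.
rewrite [leRHS](_ : _ = (2 * B) `^ q * B2 * eps + 2 * B1 * S `^ p * B3 * M).
  by rewrite addr_ge0.
by ring.
Qed.

Lemma absorb_cst_gt0 : 0 < absorb_cst.
Proof.
by rewrite addr_gt0 ?mulr_gt0 ?powR_gt0// mulr_gt0.
Qed.

End absorption.

(** * Exponential integrability and the Sobolev inequality on small level sets *)

Section weighted.
Variables (R : realType) (n : nat) (Omega : set 'rV[R]_n.+1).
Variable (v : 'rV[R]_n.+1 -> R).
Hypotheses (mO : measurable Omega) (wv : weight Omega v).
Local Notation E := 'rV[R]_n.+1.
Local Notation mu := (leb R n).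
Local Notation itg h := (mu.-integrable Omega (EFin \o h)).
Local Notation J h := (\int[mu]_(x in Omega) h x).
Implicit Types (f h phi psi : E -> R) (p sigma alpha l lam r : R).

Hypothesis iv : itg v.

Let mv : measurable_fun Omega v := wv.1.
Let v0 x : Omega x -> 0 <= v x := wv.2 x.

(** The infimum need not be attained; a bound strictly above the norm leaves room for an admissible
    scale. *)
Lemma orlicz_norm_lt (Phi : R -> R) h (Y : R) :
  (orlicz_norm Phi v Omega h < Y%:E)%E ->
  exists l, [/\ 0 < l, l < Y &
    (\int[mu]_(x in Omega) (Phi (`|h x| / l) * v x)%:E <= 1)%E].
Proof. by move=> /ereal_inf_lt[_ [l [l0 lP] <-]]; rewrite lte_fin; exists l. Qed.

Lemma measurable_A_young alpha lam f : measurable_fun Omega f ->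
  measurable_fun Omega (fun x => A_young alpha (`|f x| / lam)).
Proof.
move=> mf; apply: measurable_funB; last exact: measurable_cst.
apply: (measurableT_comp (@measurable_expR R)); apply: measurable_powR_fun.
by apply: measurable_funM; [exact: measurable_norm_fun|exact: measurable_cst].
Qed.

Lemma measurable_N_young p sigma lam f : measurable_fun Omega f ->
  measurable_fun Omega (fun x => N_young p sigma (`|f x| / lam)).
Proof.
move=> mf.
have mfl : measurable_fun Omega (fun x => `|f x| / lam).
  by apply: measurable_funM; [exact: measurable_norm_fun|exact: measurable_cst].
apply: measurable_funM; first exact: measurable_powR_fun.
apply: measurable_powR_fun; apply: (measurableT_comp (@measurable_ln R)).
by apply: measurable_funD => //; exact: measurable_cst.
Qed.

Lemma A_young_ge0 alpha t : 0 <= A_young alpha t.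
Proof. by rewrite subr_ge0 -[leLHS]expR0 ler_expR powR_ge0. Qed.

Lemma orlicz_Rintegral (Phi : R -> R) h lam :
  measurable_fun Omega (fun x => Phi (`|h x| / lam)) ->
  (forall x, 0 <= Phi (`|h x| / lam)) ->
  (\int[mu]_(x in Omega) (Phi (`|h x| / lam) * v x)%:E <= 1)%E ->
  itg (fun x => Phi (`|h x| / lam) * v x) /\
  J (fun x => Phi (`|h x| / lam) * v x) <= 1.
Proof.
move=> mPhi Phi0 Phi1.
have i : itg (fun x => Phi (`|h x| / lam) * v x).
  apply: ge0_integrable; first exact: measurable_funM.
    by move=> x Ox; rewrite mulr_ge0// v0.
  exact: (le_lt_trans Phi1 (ltry 1)).
by split => //; rewrite -lee_fin EFin_Rintegral.
Qed.

Definition data_cst p alpha (K0 : R) : R :=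
  2 `^ (p / alpha) * K0 + 2 * (2 * (p / alpha)) `^ (p / alpha).

(** [powR_le_exp_young] at |f|/lam, integrated over [e]: the first term meets the measure bound K0
    e^(-l), the second the bound 1 on the integral of A(|f|/lam), and l^(p/alpha) >= 1 merges the
    two. *)
Lemma data_integral p alpha f lam K0 l (e : E -> bool) :
  1 < p -> 0 < alpha -> 0 < lam -> measurable_fun Omega f ->
  measurable_fun Omega (fun x => (e x)%:R : R) ->
  (\int[mu]_(x in Omega) (A_young alpha (`|f x| / lam) * v x)%:E <= 1)%E ->
  1 <= l -> J (fun x => (e x)%:R * v x) <= K0 * expR (- l) ->
  itg (fun x => (e x)%:R * `|f x| `^ p * v x) /\
  J (fun x => (e x)%:R * `|f x| `^ p * v x) <=
    data_cst p alpha K0 * lam `^ p * l `^ (p / alpha) * expR (- l).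
Proof.
move=> p1 a0 lam0 mf me fA l1 hK.
have [iA A1] := orlicz_Rintegral (measurable_A_young alpha lam mf)
  (fun x => A_young_ge0 _ _) fA.
have ie : itg (fun x => (e x)%:R * v x).
  apply: (le_integrable_real mO _ iv); first exact: measurable_funM.
  move=> x Ox; rewrite ger0_norm ?mulr_ge0 ?v0//.
  by case: (e x); rewrite ?mul1r ?mul0r ?v0.
set c := 2 * (2 * (p / alpha)) `^ (p / alpha) in hK *.
pose T x := (2 * l) `^ (p / alpha) * ((e x)%:R * v x) +
   c * expR (- l) * (A_young alpha (`|f x| / lam) * v x).
have c0 : 0 <= c by rewrite mulr_ge0 ?powR_ge0.
have iT : itg T by exact: integrable_lin.
have iT' : itg (fun x => lam `^ p * T x) by exact: integrable_scale.
have le_T x : Omega x -> (e x)%:R * `|f x| `^ p * v x <= lam `^ p * T x.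
  move=> Ox; have l0 : 0 < l by lra.
  have -> : `|f x| `^ p = lam `^ p * (`|f x| / lam) `^ p.
    rewrite -powRM ?divr_ge0// ?ltW//.
    by rewrite mulrCA divff ?mulr1// gt_eqF.
  rewrite mulrCA -mulrA ler_wpM2l ?powR_ge0// /T.
  have h0 : 0 <= `|f x| / lam by rewrite divr_ge0// ltW.
  have := powR_le_exp_young p1 a0 h0 l1; rewrite -/c.
  case: (e x); rewrite ?mul1r ?mul0r => h; last first.
    by rewrite mulr0 add0r mulr_ge0 ?(mulr_ge0 c0) ?expR_ge0// mulr_ge0 ?A_young_ge0 ?v0.
  by rewrite (le_trans (ler_wpM2r (v0 Ox) h))// mulrDl !mulrA.
have ie' : itg (fun x => (e x)%:R * `|f x| `^ p * v x).
  apply: (le_integrable_real mO _ iT') => [|x Ox].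
    apply: (measurable_funM _ mv); apply: (measurable_funM me).
    exact/measurable_powR_fun/measurable_norm_fun.
  have ge0 : 0 <= (e x)%:R * `|f x| `^ p * v x.
    by rewrite !mulr_ge0 ?powR_ge0// v0.
  by rewrite ger0_norm// le_T.
split=> //; apply: (le_trans (le_Rintegral mO ie' iT' le_T)).
rewrite RintegralZl// Rintegral_lin// /data_cst -/c.
have l0 : 0 <= l by lra.
have ll : 1 <= l `^ (p / alpha).
  rewrite -[leLHS](powRr0 l); apply: ler_powR => //.
  by rewrite divr_ge0//; lra.
rewrite [leRHS](_ : _ = lam `^ p * ((2 `^ (p / alpha) * l `^ (p / alpha) *
  (K0 * expR (- l))) + c * expR (- l) * l `^ (p / alpha))); last by ring.
rewrite ler_wpM2l ?powR_ge0// powRM// lerD//.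
  by rewrite ler_wpM2l// mulr_ge0 ?powR_ge0.
by apply: ler_wpM2l; [exact: (mulr_ge0 c0 (expR_ge0 _))|exact: le_trans ll].
Qed.

Definition sobolev_cst p sigma (K0 : R) : R :=
  K0 * (2 * sigma) `^ sigma + (2 * p) `^ sigma.

(* A function vanishing outside a set of measure at most [K0 e^-l] gains the factor
   [l^-sigma] when its [L^p] norm is compared with its [L^N] norm. *)
Lemma sobolev_level p sigma Q S phi K0 l :
  1 < p -> 0 < sigma -> 0 <= S ->
  sobolev_inequality (N_young p sigma) v Q Omega p S -> Lip0 Omega phi ->
  measurable_fun Omega phi ->
  (forall x, 0 <= phi x) -> itg (fun x => phi x `^ p * v x) ->
  itg (fun x => enorm (sqrtmx (Q x) *m grad phi x) `^ p) ->
  0 <= K0 -> 1 <= l -> J (fun x => (phi x != 0)%:R * v x) <= K0 * expR (- l) ->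
  J (fun x => phi x `^ p * v x) <= sobolev_cst p sigma K0 * l `^ (- sigma) *
    (S `^ p * J (fun x => enorm (sqrtmx (Q x) *m grad phi x) `^ p)).
Proof.
move=> p1 s0 S0 sob Lphi mphi phi0 iphi iG K00 l1 hm.
set X := J _; set G := J _.
have l0 : 0 < l by lra.
have p0 : 0 < p by lra.
have G0 : 0 <= G by apply: Rintegral_ge0 => x _; exact: powR_ge0.
set c := sobolev_cst _ _ _ * _.
have c0 : 0 < c.
  rewrite mulr_gt0 ?powR_gt0// ltr_wpDl ?mulr_ge0 ?powR_ge0//.
  by rewrite powR_gt0// mulr_gt0.
(* The strict inequality puts Z^(1/p) above the Orlicz norm of [phi], hence above an admissible
   scale [t]. *)
suff XZ (Z : R) : S `^ p * G < Z -> X <= c * Z.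
  rewrite -ler_pdivrMl//; apply/ler_addgt0Pr => e e0.
  by rewrite ler_pdivrMl// XZ// ltrDl.
move=> GZ.
have SG0 : 0 <= S `^ p * G by rewrite mulr_ge0 ?powR_ge0.
have Z0 : 0 < Z by rewrite (le_lt_trans SG0).
have oZ : (orlicz_norm (N_young p sigma) v Omega phi < (Z `^ p^-1)%:E)%E.
  apply: (le_lt_trans (sob _ Lphi)).
  rewrite /QLp_norm -EFin_Rintegral// poweR_EFin -EFinM lte_fin -/G.
  have -> : S = (S `^ p) `^ p^-1 by rewrite -powRrM mulfV ?gt_eqF// powRr1.
  rewrite -powRM ?powR_ge0// gt0_ltr_powR ?invr_gt0 ?nnegrE// ltW//.
have [t [t0 tZ hN]] := orlicz_norm_lt oZ.
have [iN N1] := orlicz_Rintegral (measurable_N_young p sigma t mphi)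
  (fun x => N_young_ge0 _ _ (divr_ge0 (normr_ge0 _) (ltW t0))) hN.
have ie : itg (fun x => (phi x != 0)%:R * v x).
  apply: (le_integrable_real mO _ iv) => [|x Ox].
    apply: (measurable_funM _ mv).
    rewrite (_ : (fun x => _) = (fun x => (0 < phi x)%R%:R)).
      exact: measurable_gt.
    by apply/funext => x; rewrite lt_neqAle phi0 andbT eq_sym.
  rewrite ger0_norm ?mulr_ge0 ?v0//.
  by case: (_ != _); rewrite ?mul1r ?mul0r ?v0.
set d := (2 * p / l) `^ sigma.
pose T x := expR (l / 2) * ((phi x != 0)%:R * v x) +
  d * (N_young p sigma (`|phi x| / t) * v x).
have iT : itg T by exact: integrable_lin.
have iT' : itg (fun x => t `^ p * T x) by exact: integrable_scale.
have le_T x : Omega x -> phi x `^ p * v x <= t `^ p * T x.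
  move=> Ox.
  have -> : phi x `^ p = t `^ p * (phi x / t) `^ p.
    rewrite -powRM ?divr_ge0// ?ltW//.
    by rewrite mulrCA divff ?mulr1// gt_eqF.
  rewrite -mulrA ler_wpM2l ?powR_ge0// /T (ger0_norm (phi0 x)).
  have h0 : 0 <= phi x / t by rewrite divr_ge0// ltW.
  have := powR_le_N_young p1 s0 h0 l0; rewrite -/d.
  rewrite mulf_eq0 invr_eq0 (gt_eqF t0) orbF => h.
  rewrite (le_trans (ler_wpM2r (v0 Ox) h))// mulrDl !mulrA lerD2r.
  by rewrite [_ * expR _]mulrC.
have XT : X <= t `^ p * J T by rewrite -RintegralZl//; exact: le_Rintegral.
have tpZ : t `^ p <= Z.
  have -> : Z = (Z `^ p^-1) `^ p by rewrite -powRrM mulVf ?gt_eqF// powRr1// ltW.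
  by apply: le_powR; exact: ltW.
rewrite (le_trans XT)// mulrC.
apply: ler_pM; [|exact: powR_ge0| |exact: tpZ].
- by apply: Rintegral_ge0 => x Ox; rewrite addr_ge0 ?mulr_ge0 ?expR_ge0
    ?powR_ge0 ?N_young_ge0 ?divr_ge0 ?v0// ltW.
have dE : d = (2 * p) `^ sigma * l `^ (- sigma).
  rewrite /d powRM ?invr_ge0 ?mulr_ge0 ?(ltW l0) ?(ltW p0)//.
  by rewrite -(powR_inv1 (ltW l0)) -powRrM mulN1r.
rewrite Rintegral_lin// /c /sobolev_cst mulrDl -dE; apply: lerD.
  (* The factor e^(l/2) times the measure bound K0 e^(-l) is K0 e^(-l/2), at most a multiple of
     l^(-sigma). *)
  apply: (le_trans (ler_wpM2l (expR_ge0 _) hm)).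
  rewrite mulrCA -expRD -mulrA ler_wpM2l//.
  rewrite (_ : _ + _ = - (l / 2)); last by lra.
  exact: expR_half_le.
by rewrite ler_piMr ?powR_ge0.
Qed.

End weighted.

(** * Testing with a truncated approximant *)

Section level_estimate.
Variables (R : realType) (n : nat) (Omega : set 'rV[R]_n.+1).
Variables (v : 'rV[R]_n.+1 -> R) (Q : 'rV[R]_n.+1 -> 'M[R]_n.+1).
Hypotheses (mO : measurable Omega) (wv : weight Omega v).
Local Notation E := 'rV[R]_n.+1.
Local Notation mu := (leb R n).
Local Notation itg h := (mu.-integrable Omega (EFin \o h)).
Local Notation J h := (\int[mu]_(x in Omega) h x).
Hypotheses (iv : itg v)
  (mQ : forall i j, measurable_fun Omega (fun x => Q x i j))
  (Qsym : forall x, Omega x -> (Q x)^T = Q x /\ nonneg_definite (Q x)).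
Implicit Types (f phi psi : E -> R) (g h : E -> 'cV[R]_n.+1).

Let mv : measurable_fun Omega v := wv.1.
Let v0 x : Omega x -> 0 <= v x := wv.2 x.

Let qn g x := enorm (sqrtmx (Q x) *m g x).
Let mfield g := forall i, measurable_fun Omega (fun x => g x i ord0).

Lemma measurable_dot_mulmx g h : mfield g -> mfield h ->
  measurable_fun Omega (fun x => dot (h x) (Q x *m g x)).
Proof.
move=> mg mh; apply: measurable_sum => i; apply: measurable_funM; first exact: mh.
under eq_fun do rewrite mxE.
by apply: measurable_sum => j; apply: measurable_funM; [exact: mQ|exact: mg].
Qed.

Lemma measurable_enorm_sqrtmx g p : mfield g ->
  measurable_fun Omega (fun x => qn g x `^ p).
Proof.
move=> mg; apply: (@eq_measurable_fun _ _ _ _ _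
    (fun x => (dot (g x) (Q x *m g x) `^ (2^-1)) `^ p)) => [x|].
  rewrite inE => Ox; have [Qs Q0] := Qsym Ox.
  by rewrite /qn enorm_sqrtmx// powR12_sqrt.
do 2 apply: measurable_powR_fun; exact: measurable_dot_mulmx.
Qed.

Lemma measurable_grad phi : continuous phi -> mfield (grad phi).
Proof.
move=> cphi i; under eq_fun do rewrite mxE.
by apply: measurable_funTS; exact: measurable_derive.
Qed.

Lemma measurable_fieldB g h : mfield g -> mfield h -> mfield (fun x => g x - h x).
Proof.
by move=> mg mh i; under eq_fun do rewrite !mxE; exact: measurable_funB.
Qed.

(** The scalar inequality for a = sqrt(Q) h and b = sqrt(Q) g; the lower bound on a.b comes from a.b
    = |b|^2 + (a - b).b and Cauchy-Schwarz. *)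
Lemma coercivity_field p g h x : 1 < p -> Omega x ->
  qn h x `^ p <= coercivity_cst p * (qn g x `^ (p - 2) * dot (h x) (Q x *m g x)) +
    coercivity_err p * qn (fun x => h x - g x) x `^ p.
Proof.
move=> p1 Ox; have [Qs Q0] := Qsym Ox.
rewrite /qn -dot_sqrtmx//; set b := _ *m g x; set a := _ *m h x.
rewrite mulmxBr -/a -/b.
apply: coercivity => //; try exact: enorm_ge0.
- by rewrite -{1}(subrK b a) addrC; exact: enormD_le.
- by rewrite mulrC; exact: cauchy_schwarz.
- rewrite -{2}(subrK b a) dotDl sqr_enorm addrC lerD2r mulrC lerNl.
  by rewrite (le_trans _ (cauchy_schwarz _ _))// -normrN ler_norm.
Qed.

Lemma enorm_sqrtmx_triangle p g h x : 0 <= p ->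
  qn h x `^ p <= 2 `^ p * (qn g x `^ p + qn (fun x => h x - g x) x `^ p).
Proof.
move=> p0; apply: powR_triangle; rewrite ?enorm_ge0// /qn mulmxBr.
by rewrite -{1}(subrK (sqrtmx (Q x) *m g x) (sqrtmx (Q x) *m h x)) addrC enormD_le.
Qed.

Variables (p sigma alpha S K0 : R).
Hypotheses (p1 : 1 < p) (sigma0 : 0 < sigma) (alpha0 : 0 < alpha).
Hypotheses (S1 : 1 <= S) (K00 : 0 <= K0).
Hypothesis sob : sobolev_inequality (N_young p sigma) v Q Omega p S.

(* The weak inequality restricted to test functions for which both sides are finite:
   in this form it is stable under the change of sign which exchanges subsolutions
   and supersolutions. *)
Definition subsolution_integrals f g : Prop :=
  forall phi, Lip0 Omega phi -> (forall x, 0 <= phi x) ->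
    let L x := qn g x `^ (p - 2) * dot (grad phi x) (Q x *m g x) in
    let F x := f x * `|f x| `^ (p - 2) * phi x * v x in
    itg L -> itg F -> J L <= J F.

Definition level_cst : R :=
  absorb_cst p S (sobolev_cst p sigma K0) (data_cst p alpha K0) (coercivity_err p)
    (coercivity_cst p).

Let p0 : 0 < p.
Proof. exact: lt_trans p1. Qed.

Let sobolev_cst_gt0 : 0 < sobolev_cst p sigma K0.
Proof. by rewrite ltr_wpDl ?mulr_ge0 ?powR_ge0// powR_gt0// mulr_gt0. Qed.

Let data_cst_gt0 : 0 < data_cst p alpha K0.
Proof.
have pa0 : 0 < p / alpha by rewrite divr_gt0.
by rewrite ltr_wpDl ?mulr_ge0 ?powR_ge0// mulr_gt0// powR_gt0// mulr_gt0.
Qed.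

Lemma level_cst_gt0 : 0 < level_cst.
Proof.
apply: absorb_cst_gt0 => //; [exact: coercivity_cst_gt0|exact: coercivity_err_gt0].
Qed.

(** One fixed approximant is tested. All integrals are first shown finite, so that [sub] applies;
    coercivity, the Sobolev inequality and the bound on the data then feed [absorption]. *)
Lemma level_estimate f g psi lam r l :
  measurable_fun Omega f -> 0 < lam ->
  (\int[mu]_(x in Omega) (A_young alpha (`|f x| / lam) * v x)%:E <= 1)%E ->
  mfield g -> itg (fun x => qn g x `^ p) ->
  subsolution_integrals f g ->
  Lip0 Omega psi -> itg (fun x => `|psi x| `^ p * v x) ->
  itg (fun x => qn (fun x => grad psi x - g x) x `^ p) ->
  0 <= r -> 1 <= l -> J (fun x => (r < psi x)%R%:R * v x) <= K0 * expR (- l) ->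
  itg (fun x => trunc r psi x `^ p * v x) /\
  J (fun x => trunc r psi x `^ p * v x) <= level_cst *
    (lam `^ p * l `^ (p / alpha - sigma * p / (p - 1)) * expR (- l) +
     J (fun x => qn (fun x => grad psi x - g x) x `^ p)).
Proof.
move=> mf lam0 fA mg ig sub Lpsi ipsi ierr r0 l1 hm.
have p10 : 0 < p - 1 by rewrite subr_gt0.
pose phi := trunc r psi.
have Lphi : Lip0 Omega phi by exact: Lip0_trunc.
have cpsi := Lip0_continuous Lpsi; have cphi := Lip0_continuous Lphi.
have mphi : measurable_fun Omega phi.
  exact/measurable_funTS/continuous_measurable.
have mpsi : measurable_fun Omega psi.
  exact/measurable_funTS/continuous_measurable.
have phi0 x : 0 <= phi x by exact: trunc_ge0.
have phiE x : (phi x != 0) = (r < psi x).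
  rewrite /phi /trunc; case: (ltP r (psi x)) => rx.
    by rewrite max_l ?subr_ge0 ?(ltW rx)// subr_eq0 gt_eqF.
  by rewrite max_r ?subr_le0// eqxx.
have gradE x : grad phi x = if r < psi x then grad psi x else 0.
  exact: grad_trunc (cpsi x).
have iphi : itg (fun x => phi x `^ p * v x).
  apply: (le_integrable_real mO _ ipsi) => [|x Ox].
    exact: (measurable_funM (measurable_powR_fun p mphi) mv).
  rewrite ger0_norm ?mulr_ge0 ?powR_ge0 ?v0//.
  rewrite ler_wpM2r ?v0// le_powR ?(ltW p0)// /phi /trunc.
  by rewrite ge_max normr_ge0 andbT (le_trans _ (ler_norm _))// gerBl.
split=> //.
have mgpsi := measurable_grad cpsi; have mgphi := measurable_grad cphi.
have iGpsi : itg (fun x => qn (grad psi) x `^ p).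
  apply: (le_integrable_real mO (measurable_enorm_sqrtmx p mgpsi)
    (integrable_scale mO (2 `^ p) (integrable_lin mO 1 1 ig ierr))) => x Ox.
  by rewrite !mul1r (ger0_norm (powR_ge0 _ _)); exact/enorm_sqrtmx_triangle/ltW.
have iG : itg (fun x => qn (grad phi) x `^ p).
  apply: (le_integrable_real mO (measurable_enorm_sqrtmx p mgphi) iGpsi) => x Ox.
  rewrite (ger0_norm (powR_ge0 _ _)); apply: le_powR; first exact: ltW.
    exact: enorm_ge0.
  rewrite /qn gradE; case: ifP => _; first exact: lexx.
  by rewrite mulmx0 /enorm dot0l sqrtr0 sqrtr_ge0.
pose L x := qn g x `^ (p - 2) * dot (grad phi x) (Q x *m g x).
pose F x := f x * `|f x| `^ (p - 2) * phi x * v x.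
pose H x := `|f x| `^ (p - 1) * phi x * v x.
have iL : itg L.
  apply: (le_integrable_real mO _ (integrable_lin mO 1 1 iG ig)) => [|x Ox].
    apply: measurable_funM; first exact: measurable_enorm_sqrtmx.
    exact: measurable_dot_mulmx.
  have [Qs Q0] := Qsym Ox.
  rewrite !mul1r normrM ger0_norm ?powR_ge0// -dot_sqrtmx//.
  have cs := cauchy_schwarz (sqrtmx (Q x) *m grad phi x) (sqrtmx (Q x) *m g x).
  rewrite (le_trans (ler_wpM2l (powR_ge0 _ _) cs))// mulrCA mulrC.
  rewrite -/(qn g x) powR_subr2 ?enorm_ge0//.
  have := powR_young p1 (ltr01 : 0 < 1 :> R) (enorm_ge0 _ : 0 <= qn g x)
    (enorm_ge0 _ : 0 <= qn (grad phi) x).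
  by rewrite invr1 powR1 !mul1r.
have [iD D1] := data_integral mO wv iv p1 alpha0 lam0 mf (measurable_gt r mpsi)
  fA l1 hm.
have le_H tau x : 0 < tau -> Omega x -> H x <=
    tau * (phi x `^ p * v x) +
    tau^-1 `^ (p - 1)^-1 * ((r < psi x)%R%:R * `|f x| `^ p * v x).
  move=> tau0 Ox; rewrite /H !mulrA -mulrDl ler_wpM2r ?v0//.
  (* [phi] vanishes off {psi > r}, so Young's inequality is used on that set only and its |f|^p term
     stays localised there. *)
  rewrite -phiE; have [phix|_] := eqVneq (phi x) 0; last first.
    by rewrite mulr1; exact: powR_young.
  by rewrite phix powR0 ?gt_eqF// !mulr0 mul0r addr0.
have iH : itg H.
  apply: (le_integrable_real mO _ (integrable_lin mO 1 (1^-1 `^ (p - 1)^-1) iphi iD)).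
    apply: (measurable_funM _ mv); apply: (measurable_funM _ mphi).
    exact/measurable_powR_fun/measurable_norm_fun.
  by move=> x Ox; rewrite ger0_norm ?le_H// !mulr_ge0 ?powR_ge0// v0.
have FH x : Omega x -> `|F x| <= H x.
  move=> Ox; rewrite /F /H !normrM (ger0_norm (powR_ge0 _ _)).
  rewrite (ger0_norm (phi0 x)) (ger0_norm (v0 Ox)) ler_wpM2r ?v0//.
  by rewrite ler_wpM2r// mulrC powR_subr2.
have iF : itg F.
  apply: (le_integrable_real mO _ iH FH).
  apply: (measurable_funM _ mv); apply: (measurable_funM _ mphi).
  apply: (measurable_funM mf); exact/measurable_powR_fun/measurable_norm_fun.
have LF : J L <= J F.
  exact: sub.
have FHJ : J F <= J H.
  by apply: (le_Rintegral mO iF iH) => x Ox; rewrite (le_trans (ler_norm _))// FH.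
apply: (absorption p1 sigma0 S1 (coercivity_cst_gt0 p) sobolev_cst_gt0 data_cst_gt0
  (coercivity_err_gt0 p)
  (G := J (fun x => qn (grad phi) x `^ p)) (F1 := J H)
  (Fp := J (fun x => (r < psi x)%R%:R * `|f x| `^ p * v x))).
- by apply: Rintegral_ge0 => x Ox; rewrite mulr_ge0 ?powR_ge0 ?v0.
- by apply: Rintegral_ge0 => x _; exact: powR_ge0.
- exact: ltW.
- exact: l1.
- apply: (@le_trans _ _ (coercivity_cst p * J L +
    coercivity_err p * J (fun x => qn (fun x => grad psi x - g x) x `^ p))).
    rewrite -(Rintegral_lin mO _ _ iL ierr).
    apply: (le_Rintegral mO iG (integrable_lin mO _ _ iL ierr)) => x Ox.
    (* On {psi > r} the gradient of [phi] is that of [psi] and coercivity applies; elsewhere it is 0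
       and only the nonnegative error term remains. *)
    rewrite /L /qn gradE; case: ifP => _.
      exact: coercivity_field.
    rewrite dot0l !mulr0 add0r mulmx0 /enorm dot0l sqrtr0 powR0 ?gt_eqF//.
    by rewrite mulr_ge0 ?powR_ge0// ltW// coercivity_err_gt0.
  by rewrite lerD2r ler_wpM2l ?(ltW (coercivity_cst_gt0 _))// (le_trans LF).
- apply: (sobolev_level mO wv iv p1 sigma0 (le_trans ler01 S1) sob Lphi mphi phi0
    iphi iG K00 l1).
  by under eq_Rintegral do rewrite phiE.
- move=> tau tau0; rewrite -(Rintegral_lin mO _ _ iphi iD).
  apply: (le_Rintegral mO iH (integrable_lin mO _ _ iphi iD)) => x Ox.
  exact: le_H.
- exact: D1.
Qed.

End level_estimate.

(** * Iteration over the levels *)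

Section essential_bound.
Variables (R : realType) (n : nat) (Omega : set 'rV[R]_n.+1).
Variable (v : 'rV[R]_n.+1 -> R).
Hypotheses (mO : measurable Omega) (wv : weight Omega v).
Local Notation E := 'rV[R]_n.+1.
Local Notation mu := (leb R n).
Local Notation itg h := (mu.-integrable Omega (EFin \o h)).
Local Notation J h := (\int[mu]_(x in Omega) h x).
Hypothesis iv : itg v.
Implicit Types (f u w : E -> R).

Lemma integrable_level (s : R) u :
  measurable_fun Omega u -> itg (fun x => (s < u x)%R%:R * v x).
Proof.
move=> mu_; apply: (le_integrable_real mO _ iv) => [|x Ox].
  exact: (measurable_funM (measurable_gt s mu_) wv.1).
rewrite ger0_norm ?mulr_ge0 ?wv.2//.
by case: (_ < _); rewrite ?mul1r ?mul0r ?wv.2.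
Qed.

Lemma Linfty_norm_le w (t : R) : 0 <= t -> measurable_fun Omega w ->
  J (fun x => (t < `|w x|)%R%:R * v x) = 0 -> (Linfty_norm v Omega w <= t%:E)%E.
Proof.
move=> t0 mw J0; have mnw := measurable_norm_fun mw.
apply: ereal_inf_lbound; exists t => //=; split=> //.
rewrite /weight_meas integral_mkcondr -[RHS](congr1 EFin J0).
rewrite (EFin_Rintegral mO (integrable_level t mnw)); apply: eq_integral => x xO.
rewrite patchE; case: ifPn => [|/negP] xt; move: xt; rewrite inE /=.
  by move=> ->; rewrite mul1r.
by move=> /negP/negbTE ->; rewrite mul0r.
Qed.

Lemma orlicz_norm_ge0 (Phi : R -> R) f : (0 <= orlicz_norm Phi v Omega f)%E.
Proof.
by apply: le_ereal_inf_tmp => _ [l [l0 _] <-]; rewrite lee_fin ltW.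
Qed.

Lemma Linfty_norm_le_orlicz (Phi : R -> R) f w (c : R) :
  0 <= c -> measurable_fun Omega w -> (orlicz_norm Phi v Omega f < +oo)%E ->
  (forall lam, 0 < lam ->
    (\int[mu]_(x in Omega) (Phi (`|f x| / lam) * v x)%:E <= 1)%E ->
    J (fun x => (c * lam < `|w x|)%R%:R * v x) = 0) ->
  (Linfty_norm v Omega w <= c%:E * orlicz_norm Phi v Omega f)%E.
Proof.
move=> c0 mw foo wJ; have F0 := orlicz_norm_ge0 Phi f.
move: F0 foo; case FE : (orlicz_norm Phi v Omega f) => [F| |]// F0 _.
rewrite -EFinM; apply/lee_addgt0Pr => e e0.
have c1 : 0 < c + 1 by rewrite ltr_wpDl.
(* A scale this close to the norm costs at most e after multiplication by c; the denominator is c +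
   1 because c may be 0. *)
have : (orlicz_norm Phi v Omega f < (F + e / (c + 1))%:E)%E.
  by rewrite FE lte_fin ltrDl divr_gt0.
move=> /orlicz_norm_lt[lam [lam0 lamF fA]].
have cl0 : 0 <= c * lam by rewrite mulr_ge0// ltW.
apply: (le_trans (Linfty_norm_le cl0 mw (wJ _ lam0 fA))).
rewrite -EFinD lee_fin (le_trans (ler_wpM2l c0 (ltW lamF)))//.
rewrite mulrDr lerD2l mulrCA ger_pMr// ler_pdivrMr// mul1r.
by rewrite lerDl.
Qed.

End essential_bound.

(** * Decay of the measures of the level sets *)

Section iteration.
Variables (R : realType) (n : nat) (Omega : set 'rV[R]_n.+1).
Variables (v : 'rV[R]_n.+1 -> R) (Q : 'rV[R]_n.+1 -> 'M[R]_n.+1).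
Hypotheses (mO : measurable Omega) (wv : weight Omega v).
Local Notation E := 'rV[R]_n.+1.
Local Notation mu := (leb R n).
Local Notation itg h := (mu.-integrable Omega (EFin \o h)).
Local Notation J h := (\int[mu]_(x in Omega) h x).
Hypotheses (iv : itg v)
  (mQ : forall i j, measurable_fun Omega (fun x => Q x i j))
  (Qsym : forall x, Omega x -> (Q x)^T = Q x /\ nonneg_definite (Q x)).
Implicit Types (f phi psi u : E -> R) (g h : E -> 'cV[R]_n.+1).

Let mv : measurable_fun Omega v := wv.1.
Let v0 x : Omega x -> 0 <= v x := wv.2 x.

Let qn g x := enorm (sqrtmx (Q x) *m g x).
Let mfield g := forall i, measurable_fun Omega (fun x => g x i ord0).

Variables (p sigma alpha S M0 : R).
Hypotheses (p1 : 1 < p) (sigma0 : 0 < sigma) (alpha0 : 0 < alpha).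
Hypotheses (S1 : 1 <= S) (M00 : 0 < M0).

Let p0 : 0 < p.
Proof. exact: lt_trans p1. Qed.

(** The approximation contained in [QH0] at a single accuracy, with p-th powers and real integrals
    in place of extended norms; this form also survives a change of sign. *)
Definition approximable u g : Prop := forall eta, 0 < eta -> exists psi,
  [/\ Lip0 Omega psi,
      itg (fun x => `|psi x - u x| `^ p * v x) /\
        J (fun x => `|psi x - u x| `^ p * v x) <= eta
    & itg (fun x => qn (fun x => grad psi x - g x) x `^ p) /\
        J (fun x => qn (fun x => grad psi x - g x) x `^ p) <= eta].

Lemma poweR_integral_lt (w : E -> R) (eta : R) :
  measurable_fun Omega w -> (forall x, Omega x -> 0 <= w x) -> 0 < eta ->
  ((\int[mu]_(x in Omega) (w x)%:E) `^ p^-1 < (eta `^ p^-1)%:E)%E ->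
  itg w /\ J w <= eta.
Proof.
move=> mw w0 eta0; rewrite -poweR_EFin => hlt.
have hle : (\int[mu]_(x in Omega) (w x)%:E <= eta%:E)%E.
  rewrite leNgt; apply/negP => /ltW he; move: hlt; apply/negP; rewrite -leNgt.
  apply: gt0_ler_poweR => //; first by rewrite invr_ge0 ltW.
    by rewrite in_itv/= lee_fin ltW// leey.
  by rewrite in_itv/= integral_ge0 ?leey// => x Ox; rewrite lee_fin w0.
have ih : itg w by apply: (ge0_integrable mw w0); exact: le_lt_trans hle (ltry _).
by split => //; rewrite -lee_fin (EFin_Rintegral mO ih).
Qed.

Lemma poweR_integral_lty (w : E -> R) :
  measurable_fun Omega w -> (forall x, Omega x -> 0 <= w x) ->
  ((\int[mu]_(x in Omega) (w x)%:E) `^ p^-1 < +oo)%E -> itg w.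
Proof.
move=> mw w0 hoo; apply: (ge0_integrable mw w0).
by apply: lty_poweRy hoo; rewrite invr_neq0// gt_eqF.
Qed.

Lemma measurable_Lp u : measurable_fun Omega u ->
  measurable_fun Omega (fun x => `|u x| `^ p * v x).
Proof.
move=> mu_; apply: (measurable_funM _ mv).
exact/measurable_powR_fun/measurable_norm_fun.
Qed.

Lemma QH0_approximable u g : QH0 v Q Omega p u g ->
  [/\ measurable_fun Omega u, itg (fun x => `|u x| `^ p * v x),
      mfield g, itg (fun x => qn g x `^ p) & approximable u g].
Proof.
move=> [[mu_ u_fin] [mg g_fin] [psi [Lpsi cpsi cgrad]]].
split=> //.
- apply: poweR_integral_lty u_fin; first exact: measurable_Lp.
  by move=> x Ox; rewrite mulr_ge0 ?powR_ge0 ?v0.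
- apply: poweR_integral_lty g_fin; first exact: measurable_enorm_sqrtmx.
  by move=> x Ox; exact: powR_ge0.
move=> eta eta0.
pose c : \bar R := (eta `^ p^-1)%:E.
have c0 : nbhs (0 : \bar R) [set y | (y < c)%E].
  by apply: open_nbhs_nbhs; split; [exact: open_ereal_lt_ereal|rewrite /= lte_fin powR_gt0].
have [j1 _ J1] := cpsi _ c0; have [j2 _ J2] := cgrad _ c0.
pose j := maxn j1 j2; exists (psi j).
have cpsij := Lip0_continuous (Lpsi j).
have mpsi : measurable_fun Omega (psi j).
  exact/measurable_funTS/continuous_measurable.
split; first exact: Lpsi.
- apply: (poweR_integral_lt _ _ eta0 (J1 j (leq_maxl _ _))).
    by apply: measurable_Lp; exact: measurable_funB.
  by move=> x Ox; rewrite mulr_ge0 ?powR_ge0 ?v0.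
- apply: (poweR_integral_lt _ _ eta0 (J2 j (leq_maxr _ _))).
    apply: (measurable_enorm_sqrtmx mQ Qsym).
    exact: (measurable_fieldB (measurable_grad cpsij) mg).
  by move=> x Ox; exact: powR_ge0.
Qed.

(** The bound M0 e^(-k) of one step is half of K0 e^(-(k+1)): the factor e accounts for the shift of
    the index, and the factor 2 leaves room for replacing u by an approximant. *)
Let K0 : R := 2 * expR 1 * M0.

Let K00 : 0 <= K0.
Proof. by rewrite !mulr_ge0 ?expR_ge0 ?ltW. Qed.

Let C : R := level_cst p sigma alpha S K0.

Hypothesis sob : sobolev_inequality (N_young p sigma) v Q Omega p S.

(** Each of the three increments d has its use: {psi > a + d} lies in {u > a} up to {|psi - u| > d};
    the truncation at a + d is at least d where psi >= a + 2d; and {u > a + 3d} lies in {psi >= a +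
    2d} up to {|psi - u| > d}. Chebyshev's inequality handles the exceptional sets. *)
Lemma decay_step f u g lam a d l M :
  measurable_fun Omega f -> 0 < lam ->
  (\int[mu]_(x in Omega) (A_young alpha (`|f x| / lam) * v x)%:E <= 1)%E ->
  measurable_fun Omega u -> itg (fun x => `|u x| `^ p * v x) ->
  mfield g -> itg (fun x => qn g x `^ p) -> approximable u g ->
  subsolution_integrals Omega v Q p f g ->
  0 <= a -> 0 < d -> 1 <= l ->
  J (fun x => (a < u x)%R%:R * v x) <= M -> M < K0 * expR (- l) ->
  d `^ p * J (fun x => (a + 3 * d < u x)%R%:R * v x) <=
    C * (lam `^ p * l `^ (p / alpha - sigma * p / (p - 1)) * expR (- l)).
Proof.
move=> mf lam0 fA mu_ iu mg ig app sub a0 d0 l1 hM MK.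
have dp0 : 0 < d `^ p by rewrite powR_gt0.
have C0 : 0 <= C by exact/ltW/level_cst_gt0.
set T := lam `^ p * _ * _.
apply/ler_addgt0Pr => e e0.
(* The first bound keeps the measure of {psi > a + d} at most K0 e^(-l); the second makes the total
   error (C + 1) eta at most e. *)
pose eta := Num.min (d `^ p * (K0 * expR (- l) - M)) (e / (C + 1)).
have C10 : 0 < C + 1 by rewrite ltr_wpDl.
have eta0 : 0 < eta by rewrite lt_min mulr_gt0 ?subr_gt0 ?divr_gt0.
have [psi [Lpsi [ie1 e1] [ie2 e2]]] := app _ eta0.
have mpsi : measurable_fun Omega psi.
  exact/measurable_funTS/continuous_measurable/(Lip0_continuous Lpsi).
have ipsi : itg (fun x => `|psi x| `^ p * v x).
  apply: (le_integrable_real mO (measurable_Lp mpsi)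
    (integrable_scale mO (2 `^ p) (integrable_lin mO 1 1 iu ie1))) => x Ox.
  rewrite !mul1r ger0_norm; last by rewrite mulr_ge0 ?powR_ge0 ?v0.
  rewrite -mulrDl mulrA ler_wpM2r ?v0//.
  apply: powR_triangle; rewrite ?normr_ge0 ?(ltW p0)//.
  by rewrite (le_trans _ (ler_normD _ _))// addrC subrK.
have r0 : 0 <= a + d by rewrite addr_ge0// ltW.
have hm : J (fun x => (a + d < psi x)%R%:R * v x) <= K0 * expR (- l).
  pose W x := 1 * ((a < u x)%R%:R * v x) + (d `^ p)^-1 * (`|psi x - u x| `^ p * v x).
  have iW : itg W by exact: integrable_lin (integrable_level mO wv iv _ mu_) ie1.
  apply: (@le_trans _ _ (J W)).
    apply: (le_Rintegral mO (integrable_level mO wv iv _ mpsi) iW) => x Ox.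
    rewrite /W mul1r mulrA -mulrDl ler_wpM2r ?v0//.
    case: (ltP a (u x)) => au.
      by rewrite ler_wpDr ?mulr_ge0 ?powR_ge0 ?invr_ge0 ?(ltW dp0) ?ler_nat ?leq_b1.
    case: (ltP (a + d) (psi x)) => adpsi; last first.
      by rewrite add0r mulr_ge0 ?powR_ge0 ?invr_ge0 ?(ltW dp0).
    rewrite add0r mulrC ler_pdivlMr// mul1r; apply: le_powR; [exact: ltW|exact: ltW|].
    by rewrite (le_trans _ (ler_norm _))//; lra.
  rewrite (Rintegral_lin mO _ _ (integrable_level mO wv iv _ mu_) ie1) mul1r.
  have : eta <= d `^ p * (K0 * expR (- l) - M) by rewrite ge_min lexx.
  move=> /(le_trans e1); rewrite -ler_pdivrMl// => h.
  by rewrite (le_trans (lerD hM h))// addrC subrK.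
have [itr htr] := level_estimate mO wv iv mQ Qsym p1 sigma0 alpha0 S1 K00 sob
  mf lam0 fA mg ig sub Lpsi ipsi ie2 r0 l1 hm.
pose W x := 1 * (trunc (a + d) psi x `^ p * v x) + 1 * (`|psi x - u x| `^ p * v x).
have iW : itg W by exact: integrable_lin itr ie1.
apply: (@le_trans _ _ (J W)).
  rewrite -(RintegralZl _ mO (integrable_level mO wv iv _ mu_)).
  apply: (le_Rintegral mO (integrable_scale mO _ (integrable_level mO wv iv _ mu_)) iW) => x Ox.
  rewrite /W !mul1r mulrA -mulrDl ler_wpM2r ?v0//.
  case: (ltP (a + 3 * d) (u x)) => au; last first.
    by rewrite mulr0 addr_ge0 ?powR_ge0.
  rewrite mulr1; case: (lerP (a + 2 * d) (psi x)) => apsi.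
    rewrite ler_wpDr ?powR_ge0//; apply: le_powR; rewrite ?(ltW p0) ?(ltW d0)//.
    by rewrite /trunc le_max; apply/orP; left; lra.
  rewrite ler_wpDl ?powR_ge0//; apply: le_powR; rewrite ?(ltW p0) ?(ltW d0)//.
  by rewrite distrC (le_trans _ (ler_norm _))//; lra.
rewrite (Rintegral_lin mO _ _ itr ie1) !mul1r (le_trans (lerD htr e1))//.
rewrite -/C -/T mulrDr -addrA lerD2l.
have := ler_wpM2l C0 e2; have : eta <= e / (C + 1) by rewrite ge_min lexx orbT.
rewrite ler_pdivlMr// mulrDr mulr1 [eta * C]mulrC => h1 h2.
by rewrite (le_trans _ h1)// lerD2r.
Qed.

(** The factor 3 counts the increments of [decay_step]; the root of C / M0 is fitted so that C
    cancels and M0 e^(-l) remains. *)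
Definition bound_cst : R := 3 * (C / M0) `^ p^-1.

Let bound_cst_ge0 : 0 <= bound_cst.
Proof. by rewrite mulr_ge0 ?powR_ge0. Qed.

Let psum (k : nat) : R :=
  \sum_(i < k) i.+1%:R `^ (- (sigma / (p - 1) - alpha^-1)).

Let psum_ge0 k : 0 <= psum k.
Proof. by apply: sumr_ge0 => i _; exact: powR_ge0. Qed.

Hypothesis vM0 : J v <= M0.

Lemma decay f u g lam k :
  measurable_fun Omega f -> 0 < lam ->
  (\int[mu]_(x in Omega) (A_young alpha (`|f x| / lam) * v x)%:E <= 1)%E ->
  measurable_fun Omega u -> itg (fun x => `|u x| `^ p * v x) ->
  mfield g -> itg (fun x => qn g x `^ p) -> approximable u g ->
  subsolution_integrals Omega v Q p f g ->
  J (fun x => (bound_cst * lam * psum k < u x)%R%:R * v x) <= M0 * expR (- k%:R).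
Proof.
move=> mf lam0 fA mu_ iu mg ig app sub.
elim: k => [|k IH].
  rewrite /psum big_ord0 mulr0 oppr0 expR0 mulr1 (le_trans _ vM0)//.
  apply: (le_Rintegral mO (integrable_level mO wv iv _ mu_) iv) => x Ox.
  by case: (_ < _); rewrite ?mul1r ?mul0r ?v0.
have C0 : 0 < C by exact: level_cst_gt0.
have CM0 : 0 < C / M0 by rewrite divr_gt0.
set l : R := k.+1%:R; have l0 : 0 < l by rewrite ltr0n.
pose theta := sigma / (p - 1) - alpha^-1.
(* Since -p theta = p/alpha - sigma p/(p-1), the right-hand side of [decay_step] is d^p times M0
   e^(-l). *)
pose d := (C / M0) `^ p^-1 * lam * l `^ (- theta).
have d0 : 0 < d by rewrite !mulr_gt0 ?powR_gt0.
have -> : bound_cst * lam * psum k.+1 = bound_cst * lam * psum k + 3 * d.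
  by rewrite /psum big_ord_recr/= /d /bound_cst -/theta -/l; ring.
have a0 : 0 <= bound_cst * lam * psum k.
  exact: mulr_ge0 (mulr_ge0 bound_cst_ge0 (ltW lam0)) (psum_ge0 k).
have l1 : 1 <= l by rewrite ler1n.
have MK : M0 * expR (- k%:R) < K0 * expR (- l).
  rewrite /l -natr1 opprD expRD /K0.
  rewrite (_ : _ * (_ * _) = 2 * (M0 * expR (- k%:R)) * (expR 1 * expR (- 1))); last by ring.
  rewrite -expRD subrr expR0 mulr1 ltr_pMl ?mulr_gt0 ?expR_gt0//.
  by rewrite ltr1n.
have := decay_step mf lam0 fA mu_ iu mg ig app sub a0 d0 l1 IH MK.
have dp : d `^ p = C / M0 * (lam `^ p * l `^ (p / alpha - sigma * p / (p - 1))).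
  have A0 : 0 <= (C / M0) `^ p^-1 by exact: powR_ge0.
  rewrite /d (powRM _ (mulr_ge0 A0 (ltW lam0)) (powR_ge0 _ _)).
  rewrite (powRM _ A0 (ltW lam0)) -[in LHS]powRrM mulVf ?gt_eqF//.
  rewrite (powRr1 (ltW CM0)) -powRrM -mulrA.
  by congr (_ * (_ * _ `^ _)); rewrite /theta; ring.
have -> : C * (lam `^ p * l `^ (p / alpha - sigma * p / (p - 1)) * expR (- l)) =
    d `^ p * (M0 * expR (- l)).
  by rewrite dp; field; rewrite gt_eqF.
by rewrite ler_pM2l// powR_gt0.
Qed.

(** This level is at least every level reached by the iteration, so the measure is at most M0 e^(-k)
    for all k. *)
Lemma level_null f u g lam B :
  (forall k, psum k <= B) ->
  measurable_fun Omega f -> 0 < lam ->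
  (\int[mu]_(x in Omega) (A_young alpha (`|f x| / lam) * v x)%:E <= 1)%E ->
  measurable_fun Omega u -> itg (fun x => `|u x| `^ p * v x) ->
  mfield g -> itg (fun x => qn g x `^ p) -> approximable u g ->
  subsolution_integrals Omega v Q p f g ->
  J (fun x => (bound_cst * B * lam < u x)%R%:R * v x) = 0.
Proof.
move=> psumB mf lam0 fA mu_ iu mg ig app sub.
set t := bound_cst * B * lam.
have Jt k : J (fun x => (t < u x)%R%:R * v x) <= M0 * expR (- k%:R).
  apply: le_trans (decay k mf lam0 fA mu_ iu mg ig app sub).
  apply: (le_Rintegral mO (integrable_level mO wv iv _ mu_) (integrable_level mO wv iv _ mu_)) => x Ox.
  rewrite ler_wpM2r ?v0// ler_nat; case: (ltP t) => //= tu.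
  suff /le_lt_trans/(_ tu) -> : bound_cst * lam * psum k <= t by [].
  by rewrite /t mulrAC ler_wpM2r ?(ltW lam0)// ler_wpM2l.
apply/eqP; rewrite eq_le; apply/andP; split; last first.
  by apply: Rintegral_ge0 => x Ox; rewrite mulr_ge0 ?v0.
apply/ler_addgt0Pr => e e0; rewrite add0r.
have [k Mk] : exists k : nat, M0 / e < k%:R.
  by exists (Num.bound (M0 / e)); rewrite archi_boundP// divr_ge0 ?ltW.
rewrite (le_trans (Jt k))// expRN ler_pdivrMr ?expR_gt0//.
rewrite mulrC -ler_pdivrMr// (le_trans (ltW Mk))//.
by rewrite (le_trans _ (expR_ge1Dx _))// lerDr.
Qed.

Lemma psum_bounded : 1 < sigma / (p - 1) - alpha^-1 ->
  exists2 B, 0 <= B & forall k, psum k <= B.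
Proof.
move=> /sum_powR_bounded[B BP]; exists B => //.
exact: le_trans (psum_ge0 0) (BP 0%N).
Qed.

End iteration.


(** * Supersolutions *)

Section opposite.
Variables (R : realType) (n : nat) (Omega : set 'rV[R]_n.+1).
Variables (v : 'rV[R]_n.+1 -> R) (Q : 'rV[R]_n.+1 -> 'M[R]_n.+1) (p : R).
Local Notation E := 'rV[R]_n.+1.
Local Notation mu := (leb R n).
Local Notation itg h := (mu.-integrable Omega (EFin \o h)).
Local Notation J h := (\int[mu]_(x in Omega) h x).
Implicit Types (f u phi : E -> R) (g : E -> 'cV[R]_n.+1) (x w : E).

Lemma derive_opp phi w x : 'D_w (- phi) x = - 'D_w phi x.
Proof.
have [d|nd] := pselect (derivable phi x w); first exact: deriveN.
rewrite (derive_not_derivable nd) oppr0; apply: derive_not_derivable => d.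
by apply: nd; rewrite -[phi]opprK; exact: derivableN.
Qed.

Lemma grad_opp phi x : grad (- phi) x = - grad phi x.
Proof. by apply/colP => i; rewrite !mxE derive_opp. Qed.

Lemma Lip0_opp phi : Lip0 Omega phi -> Lip0 Omega (- phi).
Proof.
move=> [lip cphi phiO].
have -> : (Lip0 Omega (- phi)) = (Lip0 Omega (fun x => - phi x)) by [].
rewrite /Lip0; under eq_set do rewrite oppr_eq0.
split=> // x /lip[U xU UP]; exists U => //; move: UP.
rewrite /lipschitz_on; apply: filterS => M MP y Uy /=.
by rewrite -opprD normrN; exact: MP.
Qed.

Lemma enorm_mulmx_opp (A : 'M[R]_n.+1) (a : 'cV[R]_n.+1) :
  enorm (A *m - a) = enorm (A *m a).
Proof.
rewrite mulmxN /enorm -[- (A *m a)]scaleN1r dotZl dotC dotZl.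
by rewrite mulrA mulrNN !mul1r.
Qed.

Lemma approximable_opp u g :
  approximable Omega v Q p u g ->
  approximable Omega v Q p (fun x => - u x) (fun x => - g x).
Proof.
move=> app eta eta0; have [psi [Lpsi hpsi hgrad]] := app _ eta0.
exists (- psi); split; first exact: Lip0_opp.
- have -> : (fun x => `|(- psi) x - - u x| `^ p * v x) =
    (fun x => `|psi x - u x| `^ p * v x).
    by apply/funext => x; rewrite -opprD normrN.
  exact: hpsi.
- have -> : (fun x => enorm (sqrtmx (Q x) *m (grad (- psi) x - - g x)) `^ p) =
    (fun x => enorm (sqrtmx (Q x) *m (grad psi x - g x)) `^ p).
    by apply/funext => x; rewrite grad_opp -opprD enorm_mulmx_opp.
  exact: hgrad.
Qed.

Hypothesis mO : measurable Omega.

Lemma weak_subsolution_integrals f u g : weak_subsolution v Q Omega p f u g ->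
  subsolution_integrals Omega v Q p f g.
Proof.
move=> [_ sub] phi Lphi phi0 L F iL iF.
by rewrite -lee_fin (EFin_Rintegral mO iL) (EFin_Rintegral mO iF); exact: sub.
Qed.

(** Both integrands are odd under (f, g) |-> (-f, -g), so the reversed inequality becomes that of a
    subsolution, and the argument applies to -u. *)
Lemma weak_supersolution_integrals f u g : weak_supersolution v Q Omega p f u g ->
  subsolution_integrals Omega v Q p (fun x => - f x) (fun x => - g x).
Proof.
move=> [_ sup] phi Lphi phi0 L F.
pose L' x := enorm (sqrtmx (Q x) *m g x) `^ (p - 2) * dot (grad phi x) (Q x *m g x).
pose F' x := f x * `|f x| `^ (p - 2) * phi x * v x.
have -> : L = (fun x => -1 * L' x).
  apply/funext => x; rewrite /L /L' enorm_mulmx_opp mulmxN -[- (Q x *m _)]scaleN1r.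
  by rewrite [dot (grad phi x) (-1 *: _)]dotC dotZl mulrCA [dot _ (grad _ _)]dotC.
have -> : F = (fun x => -1 * F' x).
  by apply/funext => x; rewrite /F /F' normrN !mulrA mulN1r.
move=> iL iF.
have iL' : itg L'.
  rewrite (_ : L' = (fun x => -1 * (-1 * L' x))); first exact: integrable_scale.
  by apply/funext => x; rewrite mulrA mulrNN !mul1r.
have iF' : itg F'.
  rewrite (_ : F' = (fun x => -1 * (-1 * F' x))); first exact: integrable_scale.
  by apply/funext => x; rewrite mulrA mulrNN !mul1r.
rewrite (RintegralZl _ mO iL') (RintegralZl _ mO iF') !mulN1r lerN2.
by rewrite -lee_fin (EFin_Rintegral mO iL') (EFin_Rintegral mO iF'); exact: sup.
Qed.

End opposite.

(** * Choice of the constant and conclusion *)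

Unset Implicit Arguments.

Theorem theorem1p5 (R : realType) (n : nat) (Omega : set 'rV[R]_n.+1)
    (p sigma alpha S_N : R) (v : 'rV[R]_n.+1 -> R) :
  bounded_domain Omega ->
  1 < p ->
  weight Omega v ->
  (leb R n).-integrable Omega (EFin \o v) ->
  p - 1 < sigma ->
  (p - 1) / (sigma - p + 1) < alpha ->
  exists C : R,
    forall (Q : 'rV[R]_n.+1 -> 'M[R]_n.+1) (k : R),
      (forall i j, measurable_fun Omega (fun x => Q x i j)) ->
      (forall x, Omega x -> (Q x)^T = Q x /\ nonneg_definite (Q x)) ->
      {ae leb R n, forall x, Omega x -> op_norm (Q x) `^ (p / 2) <= k * v x} ->
      sobolev_inequality (N_young p sigma) v Q Omega p S_N ->
      forall f : 'rV[R]_n.+1 -> R,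
        in_orlicz (A_young alpha) v Omega f ->
        forall (u : 'rV[R]_n.+1 -> R) (gradu : 'rV[R]_n.+1 -> 'cV[R]_n.+1),
          [/\ weak_subsolution v Q Omega p f u gradu ->
                (Linfty_norm v Omega (u^\+)%R
                   <= C%:E * orlicz_norm (A_young alpha) v Omega f)%E,
              weak_supersolution v Q Omega p f u gradu ->
                (Linfty_norm v Omega (u^\-)%R
                   <= C%:E * orlicz_norm (A_young alpha) v Omega f)%E
            & weak_solution v Q Omega p f u gradu ->
                in_Linfty v Omega u /\
                (Linfty_norm v Omega u
                   <= C%:E * orlicz_norm (A_young alpha) v Omega f)%E].
Proof.
move=> [_ /measurable_open mO _ _] p1 wv iv sp ap.
have p10 : 0 < p - 1 by rewrite subr_gt0.
have sigma0 : 0 < sigma by exact: lt_trans sp.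
have sp0 : 0 < sigma - p + 1 by lra.
have alpha0 : 0 < alpha by rewrite (lt_trans _ ap)// divr_gt0.
(* Equivalent to the lower bound on [alpha]; it makes the increments summable. *)
have theta1 : 1 < sigma / (p - 1) - alpha^-1.
  have : alpha^-1 < (sigma - p + 1) / (p - 1).
    by rewrite -invf_div ltf_pV2 ?posrE// divr_gt0.
  rewrite (_ : (sigma - p + 1) / (p - 1) = sigma / (p - 1) - 1); first by lra.
  by field; rewrite gt_eqF.
have [B B0 psumB] := psum_bounded theta1.
(* Enlarging the constant preserves the Sobolev inequality and makes it positive. *)
pose S := Num.max S_N 1; have S1 : 1 <= S by rewrite le_max lexx orbT.
(* The added 1 keeps [M0] positive even when [v] vanishes almost everywhere. *)
pose M0 := \int[leb R n]_(x in Omega) v x + 1.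
have M00 : 0 < M0 by rewrite ltr_wpDl//; apply: Rintegral_ge0 => x /wv.2.
have vM0 : \int[leb R n]_(x in Omega) v x <= M0 by rewrite lerDl.
pose c := bound_cst p sigma alpha S M0 * B.
have c0 : 0 <= c by rewrite !mulr_ge0 ?powR_ge0.
(* Fixed before [Q], [f] and [u]: only p, sigma, alpha, S_N and the total mass of v enter. *)
exists c => Q k mQ Qsym _ sobN f [mf foo] u g.
have sob : sobolev_inequality (N_young p sigma) v Q Omega p S.
  move=> phi /sobN h; apply: (le_trans h); apply: lee_wpmul2r.
    exact: poweR_ge0.
  by rewrite lee_fin le_max lexx.
pose null w := forall lam, 0 < lam ->
  (\int[leb R n]_(x in Omega) (A_young alpha (`|f x| / lam) * v x)%:E <= 1)%E ->
  \int[leb R n]_(x in Omega) ((c * lam < w x)%R%:R * v x) = 0.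
have sub_null : weak_subsolution v Q Omega p f u g -> null u.
  move=> sub lam lam0 fA.
  have [mu iu mg ig app] := QH0_approximable mO wv mQ Qsym p1 sub.1.
  exact: (level_null mO wv iv mQ Qsym p1 sigma0 alpha0 S1 M00 sob vM0 psumB mf lam0 fA
    mu iu mg ig app (weak_subsolution_integrals mO sub)).
have sup_null : weak_supersolution v Q Omega p f u g -> null (fun x => - u x).
  move=> sup lam lam0 fA.
  have [mu iu mg ig app] := QH0_approximable mO wv mQ Qsym p1 sup.1.
  apply: (level_null mO wv iv mQ Qsym p1 sigma0 alpha0 S1 M00 sob vM0 psumB
    (f := fun x => - f x) _ lam0 _ _ _ _ _ (approximable_opp app)
    (weak_supersolution_integrals mO sup)).
  - exact: measurable_funN.
  - by under eq_integral do rewrite normrN.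
  - exact: measurable_funN.
  - by under eq_fun do rewrite normrN.
  - by move=> i; under eq_fun do rewrite mxE; exact: measurable_funN.
  - by under eq_fun do rewrite enorm_mulmx_opp.
have mu_QH0 : QH0 v Q Omega p u g -> measurable_fun Omega u by case=> -[].
split.
- move=> sub; have mu := mu_QH0 sub.1.
  apply: (Linfty_norm_le_orlicz mO wv iv c0 _ foo).
    exact: measurable_funrpos.
  move=> lam lam0 fA; rewrite -[RHS](sub_null sub lam lam0 fA).
  apply: eq_Rintegral => x _; congr (_ * _); congr ((nat_of_bool _)%:R).
  (* As c lam >= 0, the positive part exceeds it exactly where [u] does. *)
  rewrite /funrpos ger0_norm ?le_max ?lexx ?orbT// lt_max.
  by rewrite [_ < 0]ltNge mulr_ge0 ?(ltW lam0)// orbF.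
- move=> sup; have mu := mu_QH0 sup.1.
  apply: (Linfty_norm_le_orlicz mO wv iv c0 _ foo).
    exact: measurable_funrneg.
  move=> lam lam0 fA; rewrite -[RHS](sup_null sup lam lam0 fA).
  apply: eq_Rintegral => x _; congr (_ * _); congr ((nat_of_bool _)%:R).
  rewrite /funrneg ger0_norm ?le_max ?lexx ?orbT// lt_max.
  by rewrite [_ < 0]ltNge mulr_ge0 ?(ltW lam0)// orbF.
- move=> [uQ sol]; have mu := mu_QH0 uQ.
  have subu : null u by apply: sub_null; split=> // phi Lphi _; rewrite sol.
  have supu : null (fun x => - u x).
    by apply: sup_null; split=> // phi Lphi _; rewrite sol.
  have bound : (Linfty_norm v Omega u <=
      c%:E * orlicz_norm (A_young alpha) v Omega f)%E.
    apply: (Linfty_norm_le_orlicz mO wv iv c0 mu foo) => lam lam0 fA.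
    have mNu : measurable_fun Omega (fun x => - u x) by exact: measurable_funN.
    have cl0 : 0 <= c * lam by rewrite mulr_ge0// ltW.
    have i1 := integrable_level mO wv iv (c * lam) mu.
    have i2 := integrable_level mO wv iv (c * lam) mNu.
    (* For t = c lam >= 0, {|u| > t} is the disjoint union of {u > t} and {-u > t}; the right-hand 0
       is rewritten as the sum of their two null integrals. *)
    rewrite -[RHS](addr0 0) -{1}(mul1r 0) -{1}(subu _ lam0 fA).
    rewrite -[X in _ + X](mul1r 0) -{1}(supu _ lam0 fA) -(Rintegral_lin mO _ _ i1 i2).
    apply: eq_Rintegral => x _; rewrite !mul1r -mulrDl; congr (_ * _).
    rewrite ltr_normr; case: (ltP _ (u x)) => h1; case: (ltP _ (- u x)) => h2 //=.
    + by lra.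
    + by rewrite addr0.
    + by rewrite add0r.
    + by rewrite addr0.
  split=> //; split=> //; apply: (le_lt_trans bound).
  have F0 := orlicz_norm_ge0 Omega v (A_young alpha) f.
  by rewrite lte_mul_pinfty// ?lee_fin.
Qed.
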